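(* Let $d\ge1$ be an integer, and let $(K_k)_{k\in\mathbb{N}}$ and $(C_l)_{l\in\mathbb{N}}$ be sequences of finite positive constants. For every $0<\epsilon<1$ there is a constant $C_\epsilon$, depending only on $\epsilon$, $d$ and the sequences $(K_k),(C_l)$, such that the following holds. Let $X_1,X_2$ be $\mathbb{R}^d$-valued random variables with characteristic functions $\phi_1,\phi_2$ such that $$E[|X_1|^k]+E[|X_2|^k]\le K_k\quad\text{for all }k\in\mathbb{N},$$ and $$|\phi_1(u)|+|\phi_2(u)|\le \frac{C_l}{(1+|u|)^l}\quad\text{for all }u\in\mathbb{R}^d,\ l\in\mathbb{N}.$$ Then $$d_{TV}(X_1,X_2)\le C_\epsilon\, d_{FM}(X_1,X_2)^{1-\epsilon}.$$
   Context: $|\cdot|$ is the Euclidean norm and the characteristic function of $X$ is $\phi_X(u)=E[e^{i\langle u,X\rangle}]$. For a function $f$ on $\mathbb{R}^d$, $\|f\|_\infty=\sup_{x}|f(x)|$. Let $\mathcal{M}_1$ be the set of continuously differentiable $f:\mathbb{R}^d\to\mathbb{R}$ with $\|f\|_\infty+\|\nabla f\|_\infty\le 1$. For Borel probability measures $\mu_1,\mu_2$ on $\mathbb{R}^d$, $d_{FM}(\mu_1,\mu_2)=\sup_{f\in\mathcal{M}_1}|\int f\,d\mu_1-\int f\,d\mu_2|$ (Fortet--Mourier distance), and $d_{TV}(\mu_1,\mu_2)=\sup_{|f|\le 1}|\int f\,d\mu_1-\int f\,d\mu_2|$, the supremum being over measurable $f$ with $|f|\le 1$ (total variation distance). For random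 variables, $d_{FM}(X_1,X_2)$ and $d_{TV}(X_1,X_2)$ denote the distances between their laws. *)

(* Defs.v *)
From HB Require Import structures.
From mathcomp Require Import all_boot all_order all_algebra.
From mathcomp Require Import all_classical all_reals all_analysis.
From mathcomp.real_closed Require Export complex.

Set Implicit Arguments.
Unset Strict Implicit.
Unset Printing Implicit Defensive.
Import Order.TTheory GRing.Theory Num.Theory.
Import numFieldNormedType.Exports.

Local Open Scope classical_set_scope.
Local Open Scope ring_scope.
Local Open Scope complex_scope.

(* ['rV[R]_d] carries no measurable structure in the library: we give it the
   Borel sigma-algebra of its (norm-independent) topology. *)
Definition borel_rV (R : realType) (d : nat) :=
  g_sigma_algebraType (@open 'rV[R]_d).

Definition dotp (R : realType) (d : nat) (u x : 'rV[R]_d) : R :=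
  \sum_(i < d) u 0 i * x 0 i.

(* The library norm [`|x|] on ['rV[R]_d] is the max norm. *)
Definition enorm (R : realType) (d : nat) (x : 'rV[R]_d) : R :=
  Num.sqrt (dotp x x).

Definition expi (R : realType) (t : R) : R[i] := cos t +i* sin t.

(* The library has no integral of complex-valued functions.  [fine] only drops
   [\bar R]: it is applied below to expectations of [cos] and [sin]. *)
Definition expectationC (R : realType) (disp : measure_display)
    (T : measurableType disp) (P : probability T R) (Z : T -> R[i]) : R[i] :=
  fine 'E_P[fun w => complex.Re (Z w)] +i* fine 'E_P[fun w => complex.Im (Z w)].

Definition char_fun (R : realType) (d : nat) (disp : measure_display)
    (T : measurableType disp) (P : probability T R)
    (X : {RV P >-> borel_rV R d}) (u : 'rV[R]_d) : R[i] :=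
  expectationC P (fun w => expi (dotp u (X w))).

Definition gradient (R : realType) (d : nat) (f : 'rV[R]_d -> R)
    (x : 'rV[R]_d) : 'rV[R]_d :=
  \row_(i < d) 'D_(delta_mx 0 i) f x.

Definition continuously_differentiable (R : realType) (d : nat)
    (f : 'rV[R]_d -> R) : Prop :=
  (forall x, differentiable f x) /\ continuous (gradient f).

Definition sup_norm (R : realType) (T : Type) (f : T -> R) : \bar R :=
  ereal_sup [set `|f x|%:E | x in [set: T]].

Definition FM_test (R : realType) (d : nat) : set ('rV[R]_d -> R) :=
  [set f | continuously_differentiable f /\
           (sup_norm f + sup_norm (fun x => enorm (gradient f x)) <= 1)%E].

Definition TV_test (R : realType) (d : nat) : set (borel_rV R d -> R) :=
  [set f : borel_rV R d -> R | measurable_fun [set: borel_rV R d] f /\ forall x, `|f x| <= 1].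

Definition test_dist (R : realType) (d : nat) (F : set ('rV[R]_d -> R))
    (mu1 mu2 : probability (borel_rV R d) R) : \bar R :=
  ereal_sup [set `|\int[mu1]_x (f x)%:E - \int[mu2]_x (f x)%:E|%E | f in F].

Definition dFM (R : realType) (d : nat)
    (mu1 mu2 : probability (borel_rV R d) R) : \bar R :=
  test_dist (@FM_test R d) mu1 mu2.

Definition dTV (R : realType) (d : nat)
    (mu1 mu2 : probability (borel_rV R d) R) : \bar R :=
  test_dist (@TV_test R d) mu1 mu2.

(* Main.v *)
(* Write gap f for the difference of the integrals of f against the two laws,
   and D for their Fortet-Mourier distance.  The function cos(<u,x> - a), divided
   by 1 + |u|, is a Fortet-Mourier test function, and its gap is bounded by
   |phi_1(u)| + |phi_2(u)|; interpolating between the two bounds gives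
   |gap cos(<u,.> - a)| <= C' D^(1-eps/2) (1+|u|)^(-2d).
   A Lipschitz f with |f| <= 1 is replaced, on the cube of side L, by its discrete
   Fejer mean: a trigonometric sum over the lattice (1/L)Z^d, bounded by 1, that
   converges to f uniformly on the cube {|x_i| <= L/4}.  Summing the cosine bound
   over the lattice costs a factor of order L^(2d) uniformly in the number of
   nodes, and the moments bound the contribution of |x| > L/4 by a multiple of
   L^(-k).  Measurable f are reduced to Lipschitz ones by density in L^1 of the sum
   of the laws, and L = D^(-eps/(4d)) with k large gives the result.  Discrete means
   replace Fourier inversion, so no Lebesgue measure on R^d is involved. *)

Require Import Defs.
From HB Require Import structures.
From mathcomp Require Import all_boot all_order all_algebra.
From mathcomp Require Import all_classical all_reals all_analysis.
From mathcomp Require Import measurable_realfun ring lra.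

Set Implicit Arguments.
Unset Strict Implicit.
Unset Printing Implicit Defensive.
Import Order.TTheory GRing.Theory Num.Theory.
Import numFieldNormedType.Exports.

Local Open Scope classical_set_scope.
Local Open Scope ring_scope.

Section trigonometric_sums.
Context {R : realType}.
Implicit Types (x s t h : R) (N : nat).

Lemma sinD_2pin x n : sin (x + (pi *+ 2) *+ n) = sin x.
Proof. by rewrite (periodicn (@sinD2pi R)). Qed.

Lemma sum_cos_shift x h N : sin (h / 2) != 0 ->
  \sum_(j < N) cos (x - j%:R * h) =
  (sin (x + h / 2) - sin (x + h / 2 - N%:R * h)) / (2 * sin (h / 2)).
Proof.
move=> h0; apply: canRL (mulfK _) _; first by rewrite mulf_neq0 ?pnatr_eq0.
elim: N => [|N IH]; first by rewrite big_ord0 mul0r mul0r subr0 subrr.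
rewrite big_ord_recr/= mulrDl IH.
have -> : x + h / 2 - N%:R * h = (x - N%:R * h) + h / 2 by ring.
have -> : x + h / 2 - N.+1%:R * h = (x - N%:R * h) - h / 2.
  by rewrite -natr1; field.
by rewrite (sinD (x - N%:R * h)) (sinB (x - N%:R * h)); ring.
Qed.

Lemma sin_pi_frac_neq0 (m N : nat) : (0 < m < N)%N -> sin (m%:R * (pi *+ 2) / N%:R / 2) != 0 :> R.
Proof.
move=> /andP[m0 mN]; have N0 : 0 < N%:R :> R by rewrite ltr0n; exact: leq_ltn_trans mN.
have N1 : N%:R != 0 :> R by rewrite gt_eqF.
rewrite gt_eqF// sin_gt0_pi//.
have -> : m%:R * (pi *+ 2) / N%:R / 2 = m%:R / N%:R * pi :> R.
  by rewrite -mulr_natr; field.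
rewrite mulr_gt0 ?pi_gt0 ?divr_gt0 ?(ltr0n _ m)//=.
by rewrite gtr_pMl ?pi_gt0// ltr_pdivrMr// mul1r ltr_nat.
Qed.

Lemma sum_cos_roots x (m N : nat) : (0 < m < N)%N ->
  \sum_(j < N) cos (x - j%:R * (m%:R * (pi *+ 2) / N%:R)) = 0.
Proof.
move=> mN; have N0 : N%:R != 0 :> R.
  by case/andP: mN => _ mN; rewrite pnatr_eq0 -lt0n; exact: leq_ltn_trans mN.
rewrite sum_cos_shift ?sin_pi_frac_neq0//.
set y := x + _; rewrite -[y in sin y - _](subrK (N%:R * (m%:R * (pi *+ 2) / N%:R))).
have {2}-> : N%:R * (m%:R * (pi *+ 2) / N%:R) = (pi *+ 2) *+ m :> R.
  by rewrite -(mulr_natl _ m); field.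
by rewrite sinD_2pin subrr mul0r.
Qed.

Lemma sum_cos_roots_dist x (k l N : nat) : (k < N)%N -> (l < N)%N ->
  \sum_(j < N) cos ((k%:R - l%:R) * (x - j%:R * (pi *+ 2) / N%:R)) =
  if k == l then N%:R else 0.
Proof.
move=> kN lN; case: ltngtP => [kl|lk|->]; last first.
- under eq_bigr do rewrite subrr mul0r cos0.
  by rewrite sumr_const card_ord.
- rewrite -[RHS](@sum_cos_roots ((k%:R - l%:R) * x) (k - l) N); last first.
    by rewrite subn_gt0 lk/=; exact: leq_ltn_trans (leq_subr _ _) kN.
  apply: eq_bigr => j _; congr cos; rewrite (natrB _ (ltnW lk)).
  by move: N%:R^-1 (pi *+ 2) => a b; ring.
- rewrite -[RHS](@sum_cos_roots ((l%:R - k%:R) * x) (l - k) N); last first.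
    by rewrite subn_gt0 kl/=; exact: leq_ltn_trans (leq_subr _ _) lN.
  apply: eq_bigr => j _; rewrite -cosN; congr cos; rewrite (natrB _ (ltnW kl)).
  by move: N%:R^-1 (pi *+ 2) => a b; ring.
Qed.

(* The square of the modulus of [\sum_(k < N) expi (k s)], over [N ^ 2]. *)
Definition fejer N s : R :=
  ((\sum_(k < N) cos (k%:R * s)) ^+ 2 + (\sum_(k < N) sin (k%:R * s)) ^+ 2) /
  N%:R ^+ 2.

Lemma fejer_ge0 N s : 0 <= fejer N s.
Proof. by rewrite /fejer divr_ge0 ?addr_ge0 ?sqr_ge0. Qed.

Lemma fejerE N s :
  fejer N s = (\sum_(k < N) \sum_(l < N) cos ((k%:R - l%:R) * s)) / N%:R ^+ 2.
Proof.
congr (_ / _); rewrite !expr2 !mulr_suml -big_split/=; apply: eq_bigr => k _.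
rewrite !mulr_sumr -big_split/=; apply: eq_bigr => l _.
by rewrite mulrBl cosB.
Qed.

Lemma sum_fejer N s : (0 < N)%N ->
  \sum_(j < N) fejer N (s - j%:R * (pi *+ 2) / N%:R) = 1.
Proof.
move=> N0; have N1 : N%:R != 0 :> R by rewrite pnatr_eq0 -lt0n.
under eq_bigr do rewrite fejerE.
rewrite -mulr_suml exchange_big/=.
under eq_bigr => k _.
  rewrite exchange_big/=.
  under eq_bigr => l _ do rewrite sum_cos_roots_dist//.
  rewrite -big_mkcond/= (eq_bigl (fun l => l == k)); last first.
    by move=> l; rewrite eq_sym.
  rewrite big_pred1_eq; over.
by rewrite sumr_const card_ord -mulr_natr; field.
Qed.

Lemma fejer_sin_le N s : (0 < N)%N ->
  fejer N s * sin (s / 2) ^+ 2 <= N%:R ^- 2.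
Proof.
move=> N0; have N1 : 0 < N%:R :> R by rewrite ltr0n.
have tc n : 2 * sin (s / 2) * (\sum_(k < n) cos (k%:R * s)) =
    sin (n%:R * s - s / 2) + sin (s / 2).
  elim: n => [|n IH]; first by rewrite big_ord0 mulr0 mul0r sub0r sinN addNr.
  rewrite big_ord_recr/= mulrDr IH.
  have -> : n.+1%:R * s - s / 2 = n%:R * s + s / 2 by rewrite -natr1; field.
  by rewrite (sinD (n%:R * s) (s / 2)) sinB; ring.
have ts n : 2 * sin (s / 2) * (\sum_(k < n) sin (k%:R * s)) =
    cos (s / 2) - cos (n%:R * s - s / 2).
  elim: n => [|n IH]; first by rewrite big_ord0 mulr0 mul0r sub0r cosN subrr.
  rewrite big_ord_recr/= mulrDr IH.
  have -> : n.+1%:R * s - s / 2 = n%:R * s + s / 2 by rewrite -natr1; field.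
  by rewrite (cosD (n%:R * s) (s / 2)) cosB; ring.
rewrite /fejer mulrAC -[leRHS]mul1r ler_pM2r ?invr_gt0 ?exprn_gt0//.
have -> : forall a b c : R, (a ^+ 2 + b ^+ 2) * c ^+ 2 =
    ((2 * c * a) ^+ 2 + (2 * c * b) ^+ 2) / 4 by move=> *; field.
rewrite tc ts; set a := N%:R * s - _.
have -> : (sin a + sin (s / 2)) ^+ 2 + (cos (s / 2) - cos a) ^+ 2 =
    (cos a ^+ 2 + sin a ^+ 2) + (cos (s / 2) ^+ 2 + sin (s / 2) ^+ 2)
      - 2 * cos (a + s / 2) by rewrite (cosD a); ring.
by rewrite !cos2Dsin2; have := cos_geN1 (a + s / 2); lra.
Qed.

Lemma sin_ge_linear t : 0 <= t <= pi *+ 3 / 4 -> t / 6 <= sin t.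
Proof.
move=> /andP[t0 t1]; have p0 := @pi_gt0 R; have p4 := @pihalf_lt2 R.
have c4 : 1 / 2 <= cos (pi / 4 : R) /\ 1 / 2 <= sin (pi / 4 : R).
  have e : cos (pi / 4 : R) = sin (pi / 4).
    rewrite -[in LHS](opprK (pi / 4)) cosN -sinDpihalf; congr sin.
    by field.
  have s0 : 0 < sin (pi / 4 : R) by rewrite sin_gt0_pi//; lra.
  have := cos2Dsin2 (pi / 4 : R); rewrite e => c2.
  split; nra.
have [tl|tg] := leP t (pi / 4).
  have [->|tn0] := eqVneq t 0; first by rewrite mul0r sin0.
  have tp : 0 < t by rewrite lt_neqAle eq_sym tn0.
  have [c + e] := @MVT R sin cos 0 t tp (fun x _ => is_derive_sin x)
    (continuous_subspaceT (@continuous_sin R)).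
  rewrite in_itv/= => /andP[c0 ct].
  move: e; rewrite sin0 !subr0 => ->.
  have : cos (pi / 4 : R) <= cos c.
    have ci : c \in `[0, pi] by rewrite in_itv/=; apply/andP; split; lra.
    have qi : pi / 4 \in `[0, pi :> R] by rewrite in_itv/=; apply/andP; split; lra.
    by rewrite ltW// (ltr_cos ci qi); lra.
  case: c4 => c4 _ cc; nra.
have : sin (pi / 4 : R) <= sin t.
  have qi : pi / 4 \in `[- (pi / 2), pi / 2 :> R].
    by rewrite in_itv/=; apply/andP; split; lra.
  have [tl|tg'] := leP t (pi / 2).
    have ti : t \in `[- (pi / 2), pi / 2] by rewrite in_itv/=; apply/andP; split; lra.
    by rewrite ltW// (ltr_sin qi ti).
  have -> : sin t = sin (pi - t) by rewrite sinB sinpi cospi mul0r mulN1r sub0r opprK.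
  have [->//|ne] := eqVneq (pi / 4) (pi - t).
  have ti : pi - t \in `[- (pi / 2), pi / 2] by rewrite in_itv/=; apply/andP; split; lra.
  rewrite ltW// (ltr_sin qi ti) lt_neqAle ne/=; lra.
case: c4; lra.
Qed.

Lemma sqr_le_sin2 t : `|t| <= pi *+ 3 / 4 -> t ^+ 2 <= 36 * sin t ^+ 2.
Proof.
move=> t1; have : `|t| / 6 <= sin `|t| by apply: sin_ge_linear; rewrite normr_ge0.
have -> : sin t ^+ 2 = sin `|t| ^+ 2.
  by case: (ger0P t) => _ //; rewrite sinN sqrrN.
rewrite -real_normK ?num_real//; move: (normr_ge0 t).
by move: `|t| (sin _) => a b a0 ab; nra.
Qed.

End trigonometric_sums.

Section complex_exponential.
Context {R : realType}.
Local Open Scope complex_scope.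

Lemma expiD (a b : R) : expi (a + b) = expi a * expi b.
Proof.
rewrite /expi cosD sinD; apply/eqP; rewrite eq_complex/= eqxx/=.
by apply/eqP; ring.
Qed.

Lemma expi0 : expi 0 = 1 :> R[i].
Proof. by rewrite /expi cos0 sin0. Qed.

Lemma expi_sum (I : finType) (F : I -> R) :
  expi (\sum_i F i) = \prod_i expi (F i).
Proof. exact: (big_morph _ expiD expi0). Qed.

Lemma sum_expi (I : finType) (F : I -> R) :
  \sum_i expi (F i) = (\sum_i cos (F i)) +i* (\sum_i sin (F i)).
Proof.
by elim/big_rec3 : _ => // i a b c _ ->.
Qed.

Lemma fejer_expi (N : nat) (s : R) :
  (fejer N s)%:C = (N%:R ^- 2)%:C *
    \sum_(p : 'I_N * 'I_N) expi ((p.1%:R - p.2%:R) * s).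
Proof.
rewrite /fejer mulrC rmorphM; congr (_ * _).
have -> : \sum_(p : 'I_N * 'I_N) expi ((p.1%:R - p.2%:R) * s) =
    (\sum_(k < N) expi (k%:R * s)) * (\sum_(l < N) expi (- (l%:R * s))).
  rewrite big_distrlr/= pair_big/=; apply: eq_bigr => -[k l] _ /=.
  by rewrite -expiD mulrBl.
have cN : \sum_(l < N) cos (- (l%:R * s)) = \sum_(l < N) cos (l%:R * s).
  by apply: eq_bigr => l _; rewrite cosN.
have sN : \sum_(l < N) sin (- (l%:R * s)) = - \sum_(l < N) sin (l%:R * s).
  by rewrite -sumrN; apply: eq_bigr => l _; rewrite sinN.
rewrite !sum_expi cN sN.
apply/eqP; rewrite eq_complex/=; apply/andP; split; apply/eqP; ring.
Qed.

Lemma prod_fejer (d N : nat) (t : 'I_d -> R) :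
  \prod_i fejer N (t i) = (N%:R ^- 2) ^+ d *
    \sum_(p : {ffun 'I_d -> 'I_N * 'I_N})
      cos (\sum_i ((p i).1%:R - (p i).2%:R) * t i).
Proof.
apply: (@complexI R); rewrite rmorph_prod/=.
under eq_bigr do rewrite fejer_expi.
rewrite big_split/= prodr_const card_ord bigA_distr_bigA/=.
under eq_bigr do rewrite -expi_sum.
rewrite -rmorphXn/=.
suff -> : \sum_(p : {ffun 'I_d -> 'I_N * 'I_N})
      expi (\sum_i ((p i).1%:R - (p i).2%:R) * t i) =
    (\sum_(p : {ffun 'I_d -> 'I_N * 'I_N})
      cos (\sum_i ((p i).1%:R - (p i).2%:R) * t i))%:C by rewrite -rmorphM.
rewrite sum_expi; congr Complex.
(* Exchanging the two components of [p] changes the sign of the sum. *)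
set S := \sum_p _; suff : S = - S by move=> ?; lra.
pose sw (p : {ffun 'I_d -> 'I_N * 'I_N}) := [ffun i => ((p i).2, (p i).1)].
have swK : cancel sw sw by move=> p; apply/ffunP => i; rewrite !ffunE; case: (p i).
rewrite {1}/S (reindex_inj (can_inj swK))/= -sumrN; apply: eq_bigr => p _.
rewrite -sinN -sumrN; congr sin; apply: eq_bigr => i _.
by rewrite ffunE/= -mulNr opprB.
Qed.

End complex_exponential.

Section fejer_mean.
Context {R : realType} {d : nat}.
Implicit Types (L M : R) (N : nat) (f : 'rV[R]_d -> R) (x : 'rV[R]_d).

Definition l1_lipschitz M f :=
  forall x y, `|f x - f y| <= M * \sum_i `|x 0 i - y 0 i|.

(* The nodes form a grid of mesh [2 pi L / N] in the cube [[-pi L, pi L[^d]. *)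
Definition node L N (j : {ffun 'I_d -> 'I_N}) : 'rV[R]_d :=
  \row_i (L * ((j i)%:R * (pi *+ 2) / N%:R - pi)).

Definition frequency L N (p : {ffun 'I_d -> 'I_N * 'I_N}) : 'rV[R]_d :=
  \row_i (((p i).1%:R - (p i).2%:R) / L).

Definition fejer_mean L N f x : R :=
  \sum_(j : {ffun 'I_d -> 'I_N})
    f (node L j) * \prod_i fejer N ((x 0 i - node L j 0 i) / L).

Lemma fejer_meanE L N f x : fejer_mean L N f x =
  \sum_(j : {ffun 'I_d -> 'I_N}) f (node L j) * ((N%:R ^- 2) ^+ d *
    \sum_(p : {ffun 'I_d -> 'I_N * 'I_N})
      cos (dotp (frequency L p) x - dotp (frequency L p) (node L j))).
Proof.
apply: eq_bigr => j _; congr (_ * _); rewrite prod_fejer; congr (_ * _).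
apply: eq_bigr => p _; congr cos; rewrite /dotp -sumrB; apply: eq_bigr => i _.
by rewrite [frequency _ _ _ _]mxE; ring.
Qed.

Lemma prod_fejer_ge0 L N (j : {ffun 'I_d -> 'I_N}) x :
  0 <= \prod_i fejer N ((x 0 i - node L j 0 i) / L).
Proof. by apply: prodr_ge0 => i _; exact: fejer_ge0. Qed.

Lemma node_fejerE L N (k : nat) (a : R) : L != 0 ->
  (a - L * (k%:R * (pi *+ 2) / N%:R - pi)) / L =
  a / L + pi - k%:R * (pi *+ 2) / N%:R.
Proof. by move=> L0; move: N%:R^-1 => b; field. Qed.

Lemma sum_fejer_node L N (a : R) : L != 0 -> (0 < N)%N ->
  \sum_(k < N) fejer N ((a - L * (k%:R * (pi *+ 2) / N%:R - pi)) / L) = 1.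
Proof.
by move=> L0 N0; under eq_bigr do rewrite node_fejerE//; exact: sum_fejer.
Qed.

Lemma sum_prod_fejer L N x : L != 0 -> (0 < N)%N ->
  \sum_(j : {ffun 'I_d -> 'I_N})
    \prod_i fejer N ((x 0 i - node L j 0 i) / L) = 1.
Proof.
move=> L0 N0; under eq_bigr do under eq_bigr do rewrite mxE.
rewrite -(bigA_distr_bigA (fun i (k : 'I_N) =>
  fejer N ((x 0 i - L * (k%:R * (pi *+ 2) / N%:R - pi)) / L))).
by rewrite big1// => i _; rewrite sum_fejer_node.
Qed.

Lemma fejer_mean_le1 L N f x : L != 0 -> (0 < N)%N ->
  (forall y, `|f y| <= 1) -> `|fejer_mean L N f x| <= 1.
Proof.
move=> L0 N0 f1; rewrite -(sum_prod_fejer x L0 N0).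
apply: le_trans (ler_norm_sum _ _ _) _; apply: ler_sum => j _.
by rewrite normrM (ger0_norm (prod_fejer_ge0 _ _ _)) ler_piMl// prod_fejer_ge0.
Qed.

Lemma sum_prod_fejer_at L N x (g : 'I_d -> R -> R) i : L != 0 -> (0 < N)%N ->
  \sum_(j : {ffun 'I_d -> 'I_N})
    g i (node L j 0 i) * \prod_k fejer N ((x 0 k - node L j 0 k) / L) =
  \sum_(k < N) g i (L * (k%:R * (pi *+ 2) / N%:R - pi)) *
    fejer N ((x 0 i - L * (k%:R * (pi *+ 2) / N%:R - pi)) / L).
Proof.
move=> L0 N0.
pose y k : R := L * (k%:R * (pi *+ 2) / N%:R - pi).
pose F i' (k : 'I_N) := (if i' == i then g i (y k) else 1) *
  fejer N ((x 0 i' - y k) / L).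
transitivity (\sum_(j : {ffun 'I_d -> 'I_N}) \prod_i' F i' (j i')).
  apply: eq_bigr => j _; rewrite /F [RHS]big_split/= -big_mkcond/= big_pred1_eq.
  by rewrite mxE; congr (_ * _); apply: eq_bigr => k _; rewrite mxE.
rewrite -bigA_distr_bigA (bigD1 i)//= [X in _ * X]big1 ?mulr1.
  by apply: eq_bigr => k _; rewrite /F eqxx.
move=> k ki; rewrite -[RHS](sum_fejer_node (x 0 k) L0 N0).
by apply: eq_bigr => k' _; rewrite /F (negPf ki) mul1r.
Qed.

Lemma fejer_dist_le L N (a y delta : R) : 0 < L -> (0 < N)%N -> 0 < delta ->
  `|a| <= L / 4 -> `|y| <= L * pi ->
  `|a - y| * fejer N ((a - y) / L) <=
    L * (delta * fejer N ((a - y) / L) + 144 / delta * N%:R ^- 2).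
Proof.
move=> L0 N0 d0 aL yL; set s := (a - y) / L.
have -> : a - y = L * s by rewrite /s; field; rewrite gt_eqF.
have p2 := @pi_ge2 R.
have sp : `|s / 2| <= pi *+ 3 / 4.
  rewrite normrM [`|2^-1|]ger0_norm// /s normrM normfV (gtr0_norm L0).
  rewrite ler_pdivrMr// ler_pdivrMr//.
  by apply: le_trans (ler_normB _ _) _; nra.
rewrite normrM (gtr0_norm L0) -(mulrA L) ler_pM2l//.
have := sqr_le_sin2 sp; have := fejer_sin_le s N0; have := fejer_ge0 N s.
move: (fejer N s) (sin (s / 2) ^+ 2) (N%:R ^- 2) => k c e k0 kc.
rewrite expr_div_n => sc.
have s4 : `|s| ^+ 2 <= 144 * c by rewrite real_normK ?num_real//; lra.
have : `|s| <= delta + `|s| ^+ 2 / delta.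
  rewrite -(ler_pM2r d0) mulrDl divfK ?gt_eqF//.
  by have := sqr_ge0 (`|s| - delta); have := normr_ge0 s; nra.
move=> /(ler_wpM2r k0)/le_trans; apply; rewrite mulrDl lerD2l.
rewrite mulrAC [leRHS]mulrAC ler_pM2r ?invr_gt0//.
apply: (@le_trans _ _ (144 * c * k)); first by rewrite ler_wpM2r.
by rewrite -mulrA ler_pM2l// mulrC.
Qed.

Lemma fejer_mean_dist L N f x M delta : 0 < L -> (0 < N)%N -> 0 < delta ->
  0 <= M -> l1_lipschitz M f -> (forall i, `|x 0 i| <= L / 4) ->
  `|f x - fejer_mean L N f x| <=
    M * d%:R * L * (delta + 144 / delta / N%:R).
Proof.
move=> L0 N0 d0 M0 fM xL; have L1 : L != 0 by rewrite gt_eqF.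
have N1 : N%:R != 0 :> R by rewrite pnatr_eq0 -lt0n.
have fE : f x = \sum_(j : {ffun 'I_d -> 'I_N})
    f x * \prod_k fejer N ((x 0 k - node L j 0 k) / L).
  by rewrite -mulr_sumr sum_prod_fejer// mulr1.
rewrite {1}fE -sumrB.
apply: le_trans (ler_norm_sum _ _ _) _.
apply: (@le_trans _ _ (\sum_(j : {ffun 'I_d -> 'I_N})
    M * \sum_i (`|x 0 i - node L j 0 i| *
      \prod_k fejer N ((x 0 k - node L j 0 k) / L)))).
  apply: ler_sum => j _; rewrite -mulrBl normrM (ger0_norm (prod_fejer_ge0 _ _ _)).
  by rewrite -mulr_suml mulrA ler_wpM2r// prod_fejer_ge0.
rewrite -mulr_sumr exchange_big/= -!mulrA ler_wpM2l//.
rewrite mulr_natl -[in leRHS](card_ord d) -sumr_const; apply: ler_sum => i _.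
rewrite (@sum_prod_fejer_at L N x (fun i y => `|x 0 i - y|))//.
apply: (@le_trans _ _ (\sum_(k < N) L * (delta *
    fejer N ((x 0 i - L * (k%:R * (pi *+ 2) / N%:R - pi)) / L) +
    144 / delta * N%:R ^- 2))).
  apply: ler_sum => k _; apply: fejer_dist_le => //.
  rewrite normrM (gtr0_norm L0) ler_pM2l// ler_norml.
  have : (0 : R) <= k%:R / N%:R /\ k%:R / N%:R <= (1 : R).
    split; first by rewrite divr_ge0.
    by rewrite ler_pdivrMr ?ltr0n// mul1r ler_nat ltnW.
  rewrite mulrAC; have := @pi_gt0 R; move: (k%:R / N%:R) pi => b p p0 [b0 b1].
  by apply/andP; split; rewrite -mulr_natr; nra.
rewrite -mulr_sumr ler_pM2l// big_split/= -mulr_sumr sum_fejer_node// mulr1.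
rewrite lerD2l sumr_const card_ord -mulr_natr.
by rewrite le_eqVlt; apply/orP; left; apply/eqP; field; rewrite N1 gt_eqF.
Qed.

End fejer_mean.

Section integral_gap.
Context {disp : measure_display} {T : measurableType disp} {R : realType}.
Variables mu nu : probability T R.
Implicit Types f g : T -> R.

Definition integrable2 f : Prop :=
  mu.-integrable setT (EFin \o f) /\ nu.-integrable setT (EFin \o f).

Definition integral_gap f : R := \int[mu]_x f x - \int[nu]_x f x.

Definition integral_total f : R := \int[mu]_x f x + \int[nu]_x f x.

Lemma bounded_integrable2 f (M : R) : measurable_fun setT f ->
  (forall x, `|f x| <= M) -> integrable2 f.
Proof.
move=> mf fM.
have bf : [bounded f x | x in setT].
  by exists M; split; [exact: num_real|move=> y My x _; exact: le_trans (fM x) (ltW My)].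
by split; apply: measurable_bounded_integrable => //;
  rewrite [X in (X < _)%E]probability_setT ltry.
Qed.

Lemma integrable2D f g : integrable2 f -> integrable2 g ->
  integrable2 (fun x => f x + g x).
Proof.
move=> [fm fn] [gm gn]; split; first exact: (integrableD measurableT fm gm).
exact: (integrableD measurableT fn gn).
Qed.

Lemma integrable2B f g : integrable2 f -> integrable2 g ->
  integrable2 (fun x => f x - g x).
Proof.
move=> [fm fn] [gm gn]; split; first exact: (integrableB measurableT fm gm).
exact: (integrableB measurableT fn gn).
Qed.

Lemma integrable2Z (r : R) f : integrable2 f -> integrable2 (fun x => r * f x).
Proof.
move=> [fm fn]; split; first exact: (integrableZl measurableT r fm).
exact: (integrableZl measurableT r fn).
Qed.

Lemma integrable2_norm f : integrable2 f -> integrable2 (fun x => `|f x|).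
Proof. by move=> [fm fn]; split; exact: integrable_norm. Qed.

Lemma integrable2_cst (r : R) : integrable2 (fun=> r).
Proof. exact: (@bounded_integrable2 _ `|r|). Qed.

Lemma integral_gapD f g : integrable2 f -> integrable2 g ->
  integral_gap (fun x => f x + g x) = integral_gap f + integral_gap g.
Proof.
by move=> [fm fn] [gm gn]; rewrite /integral_gap !RintegralD//; ring.
Qed.

Lemma integral_gapB f g : integrable2 f -> integrable2 g ->
  integral_gap (fun x => f x - g x) = integral_gap f - integral_gap g.
Proof.
by move=> [fm fn] [gm gn]; rewrite /integral_gap !RintegralB//; ring.
Qed.

Lemma integral_gapZ (r : R) f : integrable2 f ->
  integral_gap (fun x => r * f x) = r * integral_gap f.
Proof. by move=> [fm fn]; rewrite /integral_gap !RintegralZl// mulrBr. Qed.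

Lemma integrable2_sum (I : finType) (F : I -> T -> R) :
  (forall i, integrable2 (F i)) -> integrable2 (fun x => \sum_i F i x).
Proof.
move=> iF; rewrite (_ : (fun x => _) = \sum_i F i).
  elim/big_ind : _ => // [|f g If Ig]; first exact: integrable2_cst.
  exact: integrable2D.
by apply/funext => x; rewrite fct_sumE.
Qed.

Lemma integral_gap_sum (I : finType) (F : I -> T -> R) :
  (forall i, integrable2 (F i)) ->
  integral_gap (fun x => \sum_i F i x) = \sum_i integral_gap (F i).
Proof.
move=> iF; rewrite (_ : (fun x => _) = \sum_i F i); last first.
  by apply/funext => x; rewrite fct_sumE.
suff [//] : integrable2 (\sum_i F i) /\
    integral_gap (\sum_i F i) = \sum_i integral_gap (F i).
elim/big_rec2 : _ => // [|i r f _ [If fE]].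
  by split; [exact: integrable2_cst|rewrite /integral_gap !Rintegral_cst//; ring].
split; first exact: integrable2D.
by rewrite -fE -integral_gapD.
Qed.

Lemma integral_totalD f g : integrable2 f -> integrable2 g ->
  integral_total (fun x => f x + g x) = integral_total f + integral_total g.
Proof.
by move=> [fm fn] [gm gn]; rewrite /integral_total !RintegralD//; ring.
Qed.

Lemma integral_totalZ (r : R) f : integrable2 f ->
  integral_total (fun x => r * f x) = r * integral_total f.
Proof. by move=> [fm fn]; rewrite /integral_total !RintegralZl// mulrDr. Qed.

Lemma integral_total_cst (r : R) : integral_total (fun=> r) = 2 * r.
Proof.
have E (P : probability T R) : \int[P]_(x in setT) r = r.
  by rewrite Rintegral_cst// [X in fine X]probability_setT mulr1.
by rewrite /integral_total !E mulr_natl mulr2n.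
Qed.

Lemma le_integral_total f g : integrable2 f -> integrable2 g ->
  (forall x, f x <= g x) -> integral_total f <= integral_total g.
Proof.
by move=> [fm fn] [gm gn] fg; rewrite /integral_total lerD// le_Rintegral.
Qed.

Lemma integral_gap_le_total f : integrable2 f ->
  `|integral_gap f| <= integral_total (fun x => `|f x|).
Proof.
move=> [fm fn]; apply: le_trans (ler_normB _ _) _.
by rewrite /integral_total lerD// le_normr_Rintegral.
Qed.

Lemma integral_gap_le2 f (M : R) : measurable_fun setT f ->
  (forall x, `|f x| <= M) -> `|integral_gap f| <= 2 * M.
Proof.
move=> mf fM; have If := bounded_integrable2 mf fM.
apply: le_trans (integral_gap_le_total If) _.
rewrite -integral_total_cst; apply: le_integral_total => //.
- exact: integrable2_norm.
- exact: integrable2_cst.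
Qed.

Lemma integral_gap_dist_le f g h : integrable2 f -> integrable2 g ->
  integrable2 h -> (forall x, `|f x - g x| <= h x) ->
  `|integral_gap f| <= `|integral_gap g| + integral_total h.
Proof.
move=> If Ig Ih fgh; have Ifg := integrable2B If Ig.
rewrite -lerBlDl; apply: le_trans (lerB_dist _ _) _.
rewrite -integral_gapB//; apply: le_trans (integral_gap_le_total Ifg) _.
by apply: le_integral_total => //; exact: integrable2_norm.
Qed.

End integral_gap.

Section borel_rV_measurability.
Context {R : realType} {d : nat}.
Implicit Types f : 'rV[R]_d -> R.

Lemma continuous_measurable_borel_rV f : continuous f ->
  measurable_fun setT (f : borel_rV R d -> R).
Proof.
move=> /continuousP cf; apply: (measurability _ (RGenOpens.measurableE R)).
move=> _ [_ [a [b ->] <-]]; rewrite setTI; apply: sub_sigma_algebra.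
exact/cf/interval_open.
Qed.

Lemma continuous_sumr (V : topologicalType) (I : finType) (F : I -> V -> R) :
  (forall i, continuous (F i)) -> continuous (fun x => \sum_i F i x).
Proof.
move=> cF; rewrite (_ : (fun x => _) = \sum_i F i); last first.
  by apply/funext => x; rewrite fct_sumE.
elim/big_ind : _ => // [|f g cf cg] x; first exact: cvg_cst.
by apply: cvgD; [exact: cf|exact: cg].
Qed.

Lemma continuous_dotp (u : 'rV[R]_d) : continuous (dotp u).
Proof.
apply: continuous_sumr => i x.
by apply: (@continuousM _ _ (fun=> u 0 i)); [exact: cst_continuous|exact: coord_continuous].
Qed.

Lemma measurable_cos_dotp (u : 'rV[R]_d) (a : R) :
  measurable_fun setT (fun x : borel_rV R d => cos (dotp u x - a)).
Proof.
apply: continuous_measurable_borel_rV => x.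
apply: (@continuous_comp _ _ _ (fun x : 'rV[R]_d => dotp u x - a) cos).
  by apply: (@continuousB _ _ _ (dotp u) (fun=> a)); [exact: continuous_dotp|exact: cst_continuous].
exact: continuous_cos.
Qed.

Lemma measurable_enorm : measurable_fun setT (fun x : borel_rV R d => enorm x).
Proof.
apply: continuous_measurable_borel_rV => x.
apply: (@continuous_comp _ _ _ (fun x : 'rV[R]_d => dotp x x) Num.sqrt).
  apply: continuous_sumr => i y.
  by apply: (@continuousM _ _ (fun z : 'rV[R]_d => z 0 i)); exact: coord_continuous.
exact: sqrt_continuous.
Qed.

Lemma l1_lipschitz_continuous f (M : R) : l1_lipschitz M f -> continuous f.
Proof.
move=> fM x.
have c : continuous (fun y : 'rV[R]_d => M * \sum_i `|x 0 i - y 0 i|).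
  move=> y; apply: (@continuousM _ _ (fun=> M)); first exact: cst_continuous.
  move: y; apply: continuous_sumr => i y.
  have h : {for y, continuous (fun z : 'rV[R]_d => x 0 i - z 0 i)}.
    apply: (@continuousB _ _ _ (fun=> x 0 i) (fun z : 'rV[R]_d => z 0 i)).
      exact: cst_continuous.
    exact: coord_continuous.
  exact: (cvg_norm h).
have := c x; rewrite /continuous_at (big1 _ _ (fun i => `|x 0 i - x 0 i|)); last first.
  by move=> i _; rewrite subrr normr0.
rewrite mulr0 => c0.
apply/(@cvgrPdist_le _ _ _ (nbhs x) (@nbhs_filter _ x)) => e e0.
move/(@cvgrPdist_le _ _ _ (nbhs x) (@nbhs_filter _ x)) : c0 => /(_ e e0); apply: filterS => y.
rewrite sub0r normrN => h; apply: le_trans (fM x y) _.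
exact: le_trans (ler_norm _) h.
Qed.

Lemma measurable_l1_lipschitz f (M : R) : l1_lipschitz M f ->
  measurable_fun setT (f : borel_rV R d -> R).
Proof. by move=> /l1_lipschitz_continuous; exact: continuous_measurable_borel_rV. Qed.

End borel_rV_measurability.

Section lattice_sums.
Context {R : realType}.

Lemma sum_inv_sqr_le2 n : \sum_(m < n) (1 + m%:R) ^- 2 <= 2 :> R.
Proof.
case: n => [|n]; first by rewrite big_ord0.
suff : \sum_(m < n.+1) (1 + m%:R) ^- 2 <= 2 - (n.+1%:R)^-1 :> R.
  by move/le_trans; apply; rewrite gerBl invr_ge0.
elim: n => [|n IH]; first by rewrite big_ord1 addr0 invr1; lra.
rewrite big_ord_recr/=; apply: (le_trans (lerD IH (lexx _))).
rewrite -[n.+2%:R]natr1 -[X in 1 + X]natr1.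
have : 0 < n.+1%:R :> R by []. 
rewrite -natr1; move: n%:R => x x0.
have -> : 1 + (x + 1) = x + 1 + 1 by ring.
suff : (x + 1 + 1) ^- 2 <= (x + 1)^-1 - (x + 1 + 1)^-1 by lra.
have -> : (x + 1)^-1 - (x + 1 + 1)^-1 = ((x + 1) * (x + 1 + 1))^-1.
  by field; apply/andP; split; rewrite gt_eqF//; lra.
by rewrite lef_pV2 ?posrE; nra.
Qed.

Lemma sum_inv_sqr_dist_le4 (k N : nat) : (k < N)%N ->
  \sum_(l < N) (1 + `|k%:R - l%:R|) ^- 2 <= 4 :> R.
Proof.
move=> kN; rewrite -(big_mkord xpredT (fun l => (1 + `|k%:R - l%:R|) ^- 2 : R)).
rewrite (@big_cat_nat _ _ _ k)//=; last exact: ltnW.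
have -> : 4 = 2 + 2 :> R by ring.
apply: lerD.
- rewrite big_nat_rev/= add0n big_mkord; apply: le_trans (sum_inv_sqr_le2 k).
  apply: ler_sum => l _; rewrite lef_pV2 ?posrE ?exprn_gt0 ?ltr_wpDr//.
  rewrite ler_pXn2r ?nnegrE ?addr_ge0// lerD2l natrB//.
  by rewrite opprB addrC subrK normr_nat ler_nat.
- rewrite -{1}(add0n k) big_addn big_mkord.
  apply: le_trans (sum_inv_sqr_le2 (N - k)).
  apply: ler_sum => l _.
  by rewrite natrD opprD addrCA subrr addr0 normrN normr_nat.
Qed.

Lemma rescaled_weight_le (L x : R) : 1 <= L ->
  (1 + `|x / L|) ^- 2 <= L ^+ 2 * (1 + `|x|) ^- 2.
Proof.
move=> L1; have L0 : 0 < L by lra.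
have x0 := normr_ge0 x.
rewrite normrM normfV (gtr0_norm L0).
have p1 : 0 < (1 + `|x|) / L by rewrite divr_gt0// ltr_wpDr.
have p2 : 0 < 1 + `|x| / L by rewrite ltr_wpDr// divr_ge0// ltW.
have -> : L ^+ 2 * (1 + `|x|) ^- 2 = ((1 + `|x|) / L) ^- 2.
  by rewrite expr_div_n invf_div.
rewrite lef_pV2 ?posrE ?exprn_gt0//.
rewrite ler_pXn2r ?nnegrE ?(ltW p1) ?(ltW p2)//.
by rewrite mulrDl mul1r lerD2r invf_le1.
Qed.

Lemma sum_frequency_weight_le (d N : nat) (L : R) : 1 <= L ->
  \sum_(p : {ffun 'I_d -> 'I_N * 'I_N})
    \prod_i (1 + `|frequency L p 0 i|) ^- 2 <= (4 * L ^+ 2 * N%:R) ^+ d.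
Proof.
move=> L1; under eq_bigr do under eq_bigr do rewrite mxE.
rewrite -(bigA_distr_bigA (fun (i : 'I_d) (q : 'I_N * 'I_N) =>
  (1 + `|(q.1%:R - q.2%:R) / L|) ^- 2)) prodr_const card_ord.
set S := \sum_q _.
have S0 : 0 <= S by apply: sumr_ge0 => q _; rewrite invr_ge0 sqr_ge0.
suff SR : S <= 4 * L ^+ 2 * N%:R.
  by rewrite lerXn2r ?nnegrE// (le_trans S0).
apply: (@le_trans _ _ (\sum_(k < N) \sum_(l < N)
    L ^+ 2 * (1 + `|k%:R - l%:R|) ^- 2)).
  rewrite pair_bigA; apply: ler_sum => -[k l] _; exact: rescaled_weight_le.
rewrite mulr_natr -[in leRHS](card_ord N) -sumr_const; apply: ler_sum => k _.
rewrite -mulr_sumr mulrC ler_wpM2r ?sqr_ge0//.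
exact: sum_inv_sqr_dist_le4.
Qed.

End lattice_sums.

Section gap_of_lipschitz.
Context {R : realType} {d : nat}.
Variables (mu nu : probability (borel_rV R d) R) (beta : R).
Hypothesis gap_cos_le : forall (u : 'rV[R]_d) (a : R),
  `|integral_gap mu nu (fun x => cos (dotp u x - a))| <=
    beta * \prod_i (1 + `|u 0 i|) ^- 2.

Lemma integrable2_cos_dotp (u : 'rV[R]_d) (a : R) :
  integrable2 mu nu (fun x => cos (dotp u x - a)).
Proof.
apply: (@bounded_integrable2 _ _ _ _ _ _ 1); first exact: measurable_cos_dotp.
by move=> x; exact: cos_max.
Qed.

Lemma integrable2_fejer_mean (L : R) (N : nat) (f : 'rV[R]_d -> R) :
  integrable2 mu nu (fejer_mean L N f).
Proof.
rewrite (_ : fejer_mean L N f = fun x => fejer_mean L N f x)//.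
under eq_fun do rewrite fejer_meanE.
apply: integrable2_sum => j; apply: integrable2Z; apply: integrable2Z.
by apply: integrable2_sum => p; exact: integrable2_cos_dotp.
Qed.

Lemma integral_gap_fejer_mean_le (L : R) (N : nat) (f : 'rV[R]_d -> R) :
  1 <= L -> (0 < N)%N -> (forall x, `|f x| <= 1) ->
  `|integral_gap mu nu (fejer_mean L N f)| <= beta * (4 * L ^+ 2) ^+ d.
Proof.
move=> L1 N0 f1; have N1 : N%:R != 0 :> R by rewrite pnatr_eq0 -lt0n.
have beta0 : 0 <= beta.
  have := gap_cos_le 0 0; rewrite big1 ?mulr1; last first.
    by move=> i _; rewrite mxE normr0 addr0 expr1n invr1.
  exact: le_trans.
have Ic (j : {ffun 'I_d -> 'I_N}) :
    integrable2 mu nu (fun x => \sum_(p : {ffun 'I_d -> 'I_N * 'I_N})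
      cos (dotp (frequency L p) x - dotp (frequency L p) (node L j))).
  by apply: integrable2_sum => p; exact: integrable2_cos_dotp.
rewrite (_ : fejer_mean L N f = fun x => fejer_mean L N f x)//.
under eq_fun do rewrite fejer_meanE.
rewrite integral_gap_sum; last first.
  by move=> j; apply: integrable2Z; exact: integrable2Z.
apply: le_trans (ler_norm_sum _ _ _) _.
apply: (@le_trans _ _ (\sum_(j : {ffun 'I_d -> 'I_N})
    (N%:R ^- 2) ^+ d * (beta * (4 * L ^+ 2 * N%:R) ^+ d))).
  apply: ler_sum => j _.
  rewrite integral_gapZ; last exact: integrable2Z.
  rewrite normrM; apply: le_trans (ler_piMl (normr_ge0 _) (f1 _)) _.
  have n0 : 0 <= (N%:R ^- 2) ^+ d :> R by rewrite exprn_ge0// invr_ge0 exprn_ge0.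
  rewrite integral_gapZ// normrM (ger0_norm n0) ler_wpM2l//.
  rewrite integral_gap_sum; last by move=> p; exact: integrable2_cos_dotp.
  apply: le_trans (ler_norm_sum _ _ _) _.
  apply: le_trans (ler_wpM2l beta0 (sum_frequency_weight_le d N L1)).
  by rewrite mulr_sumr; apply: ler_sum => p _; exact: gap_cos_le.
rewrite sumr_const card_ffun !card_ord -[_ *+ (N ^ d)]mulr_natl natrX.
rewrite mulrCA [_ * (beta * _)]mulrCA mulrCA ler_wpM2l//.
rewrite -!exprMn le_eqVlt; apply/orP; left; apply/eqP; congr (_ ^+ _).
by field.
Qed.

Lemma coord_le_enorm (x : 'rV[R]_d) i : `|x 0 i| <= enorm x.
Proof.
rewrite /enorm -sqrtr_sqr ler_wsqrtr// /dotp (bigD1 i)//= expr2 lerDl.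
by apply: sumr_ge0 => j _; rewrite -expr2 sqr_ge0.
Qed.

Lemma enorm_ge0 (x : 'rV[R]_d) : 0 <= enorm x.
Proof. exact: sqrtr_ge0. Qed.

Lemma integral_gap_lipschitz_le (L M : R) (k : nat) (f : 'rV[R]_d -> R) :
  1 <= L -> l1_lipschitz M f -> (forall x, `|f x| <= 1) ->
  integrable2 mu nu (fun x => enorm x ^+ k) ->
  `|integral_gap mu nu f| <= beta * (4 * L ^+ 2) ^+ d +
    2 * (4 / L) ^+ k * integral_total mu nu (fun x => enorm x ^+ k).
Proof.
move=> L1 fM f1 Ik; have L0 : 0 < L by lra.
have fM' : l1_lipschitz `|M| f.
  move=> x y; apply: le_trans (fM x y) _; apply: ler_wpM2r (ler_norm _).
  by apply: sumr_ge0.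
apply/ler_addgt0Pr => r r0.
pose A := `|M| * d%:R * L + 1.
have A0 : 0 < A by rewrite ltr_wpDl// !mulr_ge0// ltW.
pose delta := r / 4 / A.
have d0 : 0 < delta by rewrite !divr_gt0.
have [N N0 NA] : exists2 N, (0 < N)%N & A * (delta + 144 / delta / N%:R) <= r / 2.
  pose y := 144 * A / delta / (r / 4).
  have y0 : 0 <= y by rewrite !divr_ge0// ?mulr_ge0// ltW.
  exists (Num.bound y).+1 => //.
  have B0 : 0 < (Num.bound y).+1%:R :> R by rewrite ltr0n.
  have -> : A * (delta + 144 / delta / (Num.bound y).+1%:R) =
      r / 4 + (144 * A / delta) / (Num.bound y).+1%:R.
    rewrite /delta; field; do ?[apply/andP; split]; by rewrite gt_eqF.
  suff h : (144 * A / delta) / (Num.bound y).+1%:R <= r / 4.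
    by apply: le_trans (lerD (lexx _) h) _; lra.
  rewrite ler_pdivrMr// -ler_pdivrMl ?divr_gt0// mulrC.
  apply: ltW; apply: lt_trans (archi_boundP y0) _; by rewrite ltr_nat.
have near x : `|f x - fejer_mean L N f x| <= r / 2 + 2 * (4 / L) ^+ k * enorm x ^+ k.
  have [xL|xL] := leP (enorm x) (L / 4).
    apply: (@le_trans _ _ (r / 2)); last first.
      by rewrite lerDl !mulr_ge0 ?exprn_ge0 ?divr_ge0 ?enorm_ge0 ?(ltW L0).
    apply: le_trans (fejer_mean_dist L0 N0 d0 (normr_ge0 M) fM' _) _.
      by move=> i; exact: le_trans (coord_le_enorm x i) xL.
    apply: le_trans NA; rewrite ler_wpM2r ?addr_ge0 ?(ltW d0)//.
      by rewrite !divr_ge0// ltW.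
    by rewrite lerDl.
  apply: (@le_trans _ _ 2).
    apply: le_trans (ler_normB _ _) _.
    have -> : 2 = 1 + 1 :> R by ring.
    by rewrite lerD// fejer_mean_le1// gt_eqF.
  apply: (@le_trans _ _ (2 * (4 / L * enorm x) ^+ k)); last first.
    by rewrite exprMn mulrA lerDr divr_ge0// ltW.
  rewrite ler_peMr// exprn_ege1// -ler_pdivrMl ?divr_gt0//.
  by rewrite mulr1 invf_div ltW.
have If : integrable2 mu nu f.
  exact: bounded_integrable2 (measurable_l1_lipschitz fM) f1.
have Ir : integrable2 mu nu (fun=> r / 2) by exact: integrable2_cst.
have Ih := integrable2Z (2 * (4 / L) ^+ k) Ik.
have := integral_gap_dist_le If (@integrable2_fejer_mean L N f) (integrable2D Ir Ih) near.
rewrite integral_totalD// integral_totalZ// integral_total_cst.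
have := integral_gap_fejer_mean_le L1 N0 f1.
move=> h1 h2; apply: le_trans h2 _; lra.
Qed.

End gap_of_lipschitz.

Section lipschitz_functions.
Context {R : realType} {d : nat}.
Implicit Types (f g : 'rV[R]_d -> R) (M N : R).

Definition l1_dist (x y : 'rV[R]_d) : R := \sum_i `|x 0 i - y 0 i|.

Lemma l1_dist_ge0 x y : 0 <= l1_dist x y.
Proof. by apply: sumr_ge0. Qed.

Lemma l1_dist_triangle x y z : l1_dist x z <= l1_dist x y + l1_dist y z.
Proof.
rewrite /l1_dist -big_split/=; apply: ler_sum => i _.
exact: ler_distD.
Qed.

Lemma l1_lipschitz_cst (r : R) : l1_lipschitz 0 (fun _ : 'rV[R]_d => r).
Proof. by move=> x y; rewrite subrr normr0 mul0r. Qed.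

Lemma l1_lipschitzD f g M N : l1_lipschitz M f -> l1_lipschitz N g ->
  l1_lipschitz (M + N) (fun x => f x + g x).
Proof.
move=> fM gN x y; rewrite mulrDl opprD addrACA.
exact: le_trans (ler_normD _ _) (lerD (fM _ _) (gN _ _)).
Qed.

Lemma l1_lipschitzZ (r : R) f M : l1_lipschitz M f ->
  l1_lipschitz (`|r| * M) (fun x => r * f x).
Proof. by move=> fM x y; rewrite -mulrBr normrM -mulrA ler_wpM2l. Qed.

Lemma l1_lipschitzM f g M N : l1_lipschitz M f -> l1_lipschitz N g ->
  (forall x, `|f x| <= 1) -> (forall x, `|g x| <= 1) ->
  l1_lipschitz (M + N) (fun x => f x * g x).
Proof.
move=> fM gN f1 g1 x y.
have -> : f x * g x - f y * g y = (f x - f y) * g x + f y * (g x - g y) by ring.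
apply: le_trans (ler_normD _ _) _; rewrite [leRHS]mulrDl !normrM lerD//.
- exact: le_trans (ler_piMr (normr_ge0 _) (g1 _)) (fM _ _).
- exact: le_trans (ler_piMl (normr_ge0 _) (f1 _)) (gN _ _).
Qed.

Definition clamp (t : R) : R := Num.max (-1) (Num.min 1 t).

Lemma clamp_le1 t : `|clamp t| <= 1.
Proof.
rewrite /clamp ler_norml le_max lexx/= ge_max ge_min lexx/= andbT; lra.
Qed.

Lemma clamp_id t : `|t| <= 1 -> clamp t = t.
Proof.
rewrite ler_norml => /andP[t1 t2]; rewrite /clamp min_r//; exact: max_r.
Qed.

Lemma clamp_dist s t : `|clamp s - clamp t| <= `|s - t|.
Proof.
have cl u : [\/ u <= -1 /\ clamp u = -1, 1 <= u /\ clamp u = 1 |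
    -1 <= u <= 1 /\ clamp u = u].
  rewrite /clamp; have [u1|u1] := leP 1 u.
    by apply: Or32; split => //; apply: max_r; lra.
  have [u2|u2] := leP u (-1); first by apply: Or31.
  by apply: Or33; split => //; apply/andP; split; lra.
have := ler_norm (s - t); have := ler_norm (- (s - t)); rewrite normrN.
move: `|s - t| => v v1 v2.
by case: (cl s) => -[s1 ->]; case: (cl t) => -[t1 ->]; rewrite ler_norml;
  apply/andP; split; lra.
Qed.

Lemma l1_lipschitz_clamp f M : l1_lipschitz M f ->
  l1_lipschitz M (fun x => clamp (f x)).
Proof. by move=> fM x y; exact: le_trans (clamp_dist _ _) (fM x y). Qed.

Section distance_to_set.
Variable A : set 'rV[R]_d.
Hypothesis A0 : A !=set0.

Definition l1_set_dist (x : 'rV[R]_d) : R := inf [set l1_dist x y | y in A].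

Let has_inf_dist x : has_inf [set l1_dist x y | y in A].
Proof.
split; first by case: A0 => y Ay; exists (l1_dist x y); exists y.
by exists 0 => _ [y _ <-]; exact: l1_dist_ge0.
Qed.

Lemma l1_set_dist_lipschitz : l1_lipschitz 1 l1_set_dist.
Proof.
have le x y : l1_set_dist x <= l1_dist x y + l1_set_dist y.
  rewrite -lerBlDl; apply: lb_le_inf; first by case: (has_inf_dist y).
  move=> _ [z Az <-]; rewrite lerBlDl; apply: le_trans (l1_dist_triangle x y z).
  by apply: ge_inf; [case: (has_inf_dist x)|exists z].
move=> x y; rewrite mul1r ler_norml; apply/andP; split.
  have := le y x; rewrite (_ : l1_dist y x = \sum_i `|x 0 i - y 0 i|); first lra.
  by apply: eq_bigr => i _; rewrite distrC.
by have := le x y; rewrite /l1_dist; lra.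
Qed.

Lemma l1_set_dist_eq0 x : A x -> l1_set_dist x = 0.
Proof.
move=> Ax; apply/eqP; rewrite eq_le; apply/andP; split.
  have -> : 0 = l1_dist x x.
    by rewrite /l1_dist big1// => i _; rewrite subrr normr0.
  by apply: ge_inf; [case: (has_inf_dist x)|exists x].
by apply: lb_le_inf; [case: (has_inf_dist x)|move=> _ [y _ <-]; exact: l1_dist_ge0].
Qed.

Lemma l1_set_dist_gt0 x : open (~` A) -> ~ A x -> 0 < l1_set_dist x.
Proof.
move=> oA nAx; have : nbhs x (~` A) by exact: open_nbhs_nbhs.
move=> /nbhs_ballP[r /= r0 xr]; apply: (lt_le_trans r0).
apply: lb_le_inf; first by case: (has_inf_dist x).
move=> _ [y Ay <-]; rewrite leNgt; apply/negP => xyr.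
apply: (xr y _ Ay); split => // i j; rewrite ord1 /ball/=; apply: le_lt_trans xyr.
by rewrite /l1_dist (bigD1 j)//= lerDl sumr_ge0.
Qed.

End distance_to_set.

End lipschitz_functions.

Section lipschitz_approximation.
Context {R : realType} {d : nat}.
Variables mu nu : probability (borel_rV R d) R.
Implicit Types (f g : borel_rV R d -> R) (A : set (borel_rV R d)).

Definition lipschitz_approximable f : Prop :=
  forall e : R, 0 < e -> exists M B (g : 'rV[R]_d -> R),
    [/\ l1_lipschitz M g, forall x, `|g x| <= B &
        integral_total mu nu (fun x => `|f x - g x|) <= e].

Definition approximable f : Prop :=
  integrable2 mu nu f /\ lipschitz_approximable f.

Lemma approximable_lipschitz f M B : l1_lipschitz M f ->
  (forall x, `|f x| <= B) -> approximable f.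
Proof.
move=> fM fB; split.
  exact: bounded_integrable2 (measurable_l1_lipschitz fM) fB.
move=> e e0; exists M, B, f; split => //.
under eq_fun do rewrite subrr normr0.
by rewrite integral_total_cst mulr0 ltW.
Qed.

Lemma approximable_cst (r : R) : approximable (fun=> r).
Proof. exact: (approximable_lipschitz (l1_lipschitz_cst r) (fun=> lexx _)). Qed.

Lemma integrable2_lipschitz g M B : l1_lipschitz M g ->
  (forall x, `|g x| <= B) -> integrable2 mu nu g.
Proof.
by move=> gM gB; exact: bounded_integrable2 (measurable_l1_lipschitz gM) gB.
Qed.

Lemma approximableD f g : approximable f -> approximable g ->
  approximable (fun x => f x + g x).
Proof.
move=> [If Af] [Ig Ag]; split; first exact: integrable2D.
move=> e e0; have e2 : 0 < e / 2 by rewrite divr_gt0.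
have [M [B [f' [f'M f'B f'e]]]] := Af _ e2.
have [N [C [g' [g'N g'C g'e]]]] := Ag _ e2.
have If' := integrable2_lipschitz f'M f'B; have Ig' := integrable2_lipschitz g'N g'C.
have If1 := integrable2_norm (integrable2B If If').
have Ig1 := integrable2_norm (integrable2B Ig Ig').
exists (M + N), (B + C), (fun x => f' x + g' x); split.
- exact: l1_lipschitzD.
- by move=> x; exact: le_trans (ler_normD _ _) (lerD (f'B _) (g'C _)).
- rewrite (splitr e); apply: le_trans (lerD f'e g'e).
  rewrite -integral_totalD//; apply: le_integral_total => //.
  + by apply: integrable2_norm; apply: integrable2B; exact: integrable2D.
  + exact: integrable2D.
  + by move=> x; rewrite opprD addrACA; exact: ler_normD.
Qed.

Lemma approximableZ (r : R) f : approximable f ->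
  approximable (fun x => r * f x).
Proof.
move=> [If Af]; split; first exact: integrable2Z.
move=> e e0; have r1 : 0 < `|r| + 1 by rewrite ltr_wpDl.
have e1 : 0 < e / (`|r| + 1) by rewrite divr_gt0.
have [M [B [f' [f'M f'B f'e]]]] := Af _ e1.
have If' := integrable2_lipschitz f'M f'B.
have If1 := integrable2_norm (integrable2B If If').
exists (`|r| * M), (`|r| * B), (fun x => r * f' x); split.
- exact: l1_lipschitzZ.
- by move=> x; rewrite normrM ler_wpM2l.
- under eq_fun do rewrite -mulrBr normrM.
  rewrite integral_totalZ//.
  apply: (@le_trans _ _ (`|r| * (e / (`|r| + 1)))); first by rewrite ler_wpM2l.
  by rewrite mulrA ler_pdivrMr// mulrC ler_pM2l// lerDl.
Qed.

Lemma approximable_sum (I : finType) (F : I -> borel_rV R d -> R) :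
  (forall i, approximable (F i)) -> approximable (fun x => \sum_i F i x).
Proof.
move=> aF; rewrite (_ : (fun x => _) = \sum_i F i); last first.
  by apply/funext => x; rewrite fct_sumE.
elim/big_ind : _ => // [|f g]; first exact: approximable_cst.
exact: approximableD.
Qed.

Lemma approximable_clamp f (e : R) : approximable f ->
  (forall x, `|f x| <= 1) -> 0 < e -> exists M (g : 'rV[R]_d -> R),
    [/\ l1_lipschitz M g, forall x, `|g x| <= 1 &
        integral_total mu nu (fun x => `|f x - g x|) <= e].
Proof.
move=> [If Af] f1 e0; have [M [B [g [gM gB ge]]]] := Af _ e0.
have cM := l1_lipschitz_clamp gM.
exists M, (fun x => clamp (g x)); split => //; first by move=> x; exact: clamp_le1.
apply: le_trans ge; apply: le_integral_total.
- apply: integrable2_norm; apply: integrable2B => //.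
  by apply: (integrable2_lipschitz cM) => x; exact: clamp_le1.
- by apply: integrable2_norm; apply: integrable2B => //; exact: integrable2_lipschitz gM gB.
- by move=> x; rewrite -{1}(clamp_id (f1 x)); exact: clamp_dist.
Qed.

Lemma approximableM f g : approximable f -> approximable g ->
  (forall x, `|f x| <= 1) -> (forall x, `|g x| <= 1) ->
  measurable_fun setT f -> measurable_fun setT g ->
  approximable (fun x => f x * g x).
Proof.
move=> af ag f1 g1 mf mg; have [If _] := af; have [Ig _] := ag.
have fg1 x : `|f x * g x| <= 1.
  by rewrite normrM mulr_ile1.
have Ifg : integrable2 mu nu (fun x => f x * g x).
  by apply: (bounded_integrable2 mu nu _ fg1); exact: measurable_funM.
split => // e e0; have e2 : 0 < e / 2 by rewrite divr_gt0.
have [M [f' [f'M f'1 f'e]]] := approximable_clamp af f1 e2.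
have [N [g' [g'N g'1 g'e]]] := approximable_clamp ag g1 e2.
have If' := integrable2_lipschitz f'M f'1; have Ig' := integrable2_lipschitz g'N g'1.
have If1 := integrable2_norm (integrable2B If If').
have Ig1 := integrable2_norm (integrable2B Ig Ig').
have fgM := l1_lipschitzM f'M g'N f'1 g'1.
have fg'1 x : `|f' x * g' x| <= 1 by rewrite normrM mulr_ile1.
exists (M + N), 1, (fun x => f' x * g' x); split => //.
rewrite (splitr e); apply: le_trans (lerD f'e g'e).
rewrite -integral_totalD//; apply: le_integral_total => //.
- apply: integrable2_norm; apply: integrable2B => //.
  exact: integrable2_lipschitz fgM fg'1.
- exact: integrable2D.
- move=> x; have -> : f x * g x - f' x * g' x =
    (f x - f' x) * g x + f' x * (g x - g' x) by ring.
  apply: le_trans (ler_normD _ _) _; rewrite !normrM lerD//.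
    exact: ler_piMr.
  exact: ler_piMl.
Qed.

Lemma approximable_lim (F : nat -> borel_rV R d -> R) f :
  (forall n, approximable (F n)) -> (forall n, measurable_fun setT (F n)) ->
  (forall n x, `|F n x| <= 1) -> measurable_fun setT f ->
  (forall x, `|f x| <= 1) -> (forall x, F n x @[n --> \oo] --> f x) ->
  approximable f.
Proof.
move=> aF mF F1 mf f1 Ff.
have If := bounded_integrable2 mu nu mf f1; split => // e e0.
have cv (P : probability (borel_rV R d) R) :
    \int[P]_x `|F n x - f x| @[n --> \oo] --> (0 : R).
  have [|||||_ + _] := @dominated_convergence _ _ R P setT measurableT
    (fun n x => (F n x)%:E) (fun x => (f x)%:E) (fun=> 1%E).
  - by move=> n; exact/measurable_EFinP.
  - exact/measurable_EFinP.
  - by apply: aeW => x _; apply: cvg_EFin; [exact: nearW|exact: Ff].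
  - by have [] := integrable2_cst P P 1.
  - by apply: aeW => x n _; rewrite lee_fin.
  by move=> /fine_cvgP[_].
have e4 : 0 < e / 4 by rewrite divr_gt0.
have /cvgrPdist_lt/(_ _ e4)[n1 _ h1] := cv mu.
have /cvgrPdist_lt/(_ _ e4)[n2 _ h2] := cv nu.
pose n := maxn n1 n2.
have hn : integral_total mu nu (fun x => `|F n x - f x|) <= e / 2.
  have := h1 n (leq_maxl _ _); have := h2 n (leq_maxr _ _) => /=.
  rewrite !sub0r !normrN /integral_total => k2 k1.
  have := ler_norm (\int[mu]_x `|F n x - f x|).
  have := ler_norm (\int[nu]_x `|F n x - f x|).
  by lra.
have e2 : 0 < e / 2 by rewrite divr_gt0.
have [M [g [gM g1 ge]]] := approximable_clamp (aF n) (F1 n) e2.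
exists M, 1, g; split => //.
have Ig := integrable2_lipschitz gM g1; have [IF _] := aF n.
have I1 := integrable2_norm (integrable2B IF If).
have I2 := integrable2_norm (integrable2B IF Ig).
rewrite (splitr e); apply: le_trans (lerD hn ge).
rewrite -integral_totalD//; apply: le_integral_total => //.
- by apply: integrable2_norm; exact: integrable2B.
- exact: integrable2D.
- by move=> x; rewrite [`|F n x - f x|]distrC; exact: ler_distD.
Qed.

End lipschitz_approximation.

Section measurable_approximation.
Context {R : realType} {d : nat}.
Variables mu nu : probability (borel_rV R d) R.
Implicit Types (f : borel_rV R d -> R) (A B : set (borel_rV R d)).

Let indic_le1 A x : `|\1_A x : R| <= 1.
Proof. by rewrite indicE; case: (x \in A); rewrite ?normr1 ?normr0. Qed.

Lemma approximable_open (A : set 'rV[R]_d) :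
  open A -> approximable mu nu \1_(A : set (borel_rV R d)).
Proof.
move=> oA; have mA : measurable (A : set (borel_rV R d)) by exact: sub_sigma_algebra.
have [A0|nA0] := pselect (~` A !=set0); last first.
  rewrite (_ : \1_A = fun=> 1); first exact: approximable_cst.
  apply/funext => x; rewrite indicE mem_set//.
  by apply: contrapT => nAx; apply: nA0; exists x.
pose F (n : nat) x := clamp (n%:R * l1_set_dist (~` A) x).
have FM n : l1_lipschitz (`|n%:R| * 1) (F n).
  by apply: l1_lipschitz_clamp; apply: l1_lipschitzZ; exact: l1_set_dist_lipschitz.
have F1 n x : `|F n x| <= 1 by exact: clamp_le1.
apply: (@approximable_lim _ _ _ _ F) => //.
- by move=> n; exact: approximable_lipschitz (FM n) (F1 n).
- by move=> n; exact: measurable_l1_lipschitz (FM n).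
move=> x; rewrite indicE; have [Ax|nAx] := pselect (A x); last first.
  rewrite memNset//; apply: cvg_near_cst; apply: nearW => n.
  by rewrite /F l1_set_dist_eq0// mulr0 clamp_id// normr0.
rewrite mem_set//; have d0 : 0 < l1_set_dist (~` A) x.
  by apply: l1_set_dist_gt0 => //; rewrite setCK.
apply: cvg_near_cst; exists (Num.bound (l1_set_dist (~` A) x)^-1) => // n /= xn.
have nd : 1 <= n%:R * l1_set_dist (~` A) x.
  rewrite -ler_pdivrMr// mul1r; apply: le_trans (ltW (archi_boundP _)) _.
    by rewrite invr_ge0 ltW.
  by rewrite ler_nat.
by rewrite /F /clamp min_l// max_r//; lra.
Qed.

Lemma approximable_indic A : measurable A -> approximable mu nu \1_A.
Proof.
suff /(_ A) : (@open 'rV[R]_d).-sigma.-measurable `<=`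
    [set B : set (borel_rV R d) | measurable B /\ approximable mu nu \1_B].
  by move=> h /h[].
apply: smallest_sub; last first.
  by move=> B oB; split; [exact: sub_sigma_algebra|exact: approximable_open].
have setC B : measurable B /\ approximable mu nu \1_B ->
    measurable (~` B) /\ approximable mu nu \1_(~` B).
  move=> [mB aB]; split; first exact: measurableC.
  rewrite (_ : \1_(~` B) = fun x => 1 + -1 * \1_B x).
    by apply: approximableD; [exact: approximable_cst|exact: approximableZ].
  by apply/funext => x; rewrite !indicE in_setC; case: (x \in B) => /=; ring.
have setI B C : measurable B /\ approximable mu nu \1_B ->
    measurable C /\ approximable mu nu \1_C ->
    measurable (B `&` C) /\ approximable mu nu \1_(B `&` C).
  move=> [mB aB] [mC aC]; split; first exact: measurableI.
  rewrite (_ : \1_(B `&` C) = fun x => \1_B x * \1_C x).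
    by apply: approximableM => //; exact: measurable_indic.
  by apply/funext => x; rewrite !indicE in_setI -natrM mulnb.
split.
- split=> //; rewrite (_ : \1_set0 = fun=> 0); first exact: approximable_cst.
  by apply/funext => x; rewrite indicE in_set0.
- by move=> B hB; rewrite setTD; exact: setC.
move=> F hF.
pose U n : set (borel_rV R d) := \big[setU/set0]_(i < n) F i.
have hU n : measurable (U n) /\ approximable mu nu \1_(U n).
  elim: n => [|n IH].
    rewrite /U big_ord0; split=> //.
    rewrite (_ : \1_set0 = fun=> 0); first exact: approximable_cst.
    by apply/funext => x; rewrite indicE in_set0.
  rewrite /U big_ord_recr/= -[_ `|` _]setCK setCU.
  apply: (setC); apply: setI; apply: setC; [exact: IH|exact: hF].
have mF : measurable (\bigcup_k F k : set (borel_rV R d)).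
  by apply: bigcupT_measurable => k; case: (hF k).
split => //.
apply: (@approximable_lim _ _ _ _ (fun n => \1_(U n))) => //.
- by move=> n; case: (hU n).
- by move=> n; apply: measurable_indic; case: (hU n).
move=> x; rewrite indicE; have [Ax|nAx] := pselect ((\bigcup_k F k) x).
  rewrite mem_set//; case: Ax => k _ Fkx; apply: cvg_near_cst.
  exists k.+1 => // n /= kn; rewrite indicE mem_set//.
  by rewrite /U -bigcup_mkord; exists k.
rewrite memNset//; apply: cvg_near_cst; apply: nearW => n.
rewrite indicE memNset// /U -bigcup_mkord => -[k _ Fkx].
by apply: nAx; exists k.
Qed.

Lemma count_lt_dist (N : nat) (y : R) : 0 <= y <= N%:R ->
  `|\sum_(k < N) (k%:R < y)%R%:R - y| <= 1.
Proof.
elim: N => [|N IH] /andP[y0 yN].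
  have -> : y = 0 by apply/eqP; rewrite eq_le y0 andbT.
  by rewrite big_ord0 subr0 normr0.
rewrite big_ord_recr/=; have [yN'|yN'] := leP y N%:R.
  by rewrite addr0; apply: IH; rewrite y0.
rewrite (eq_bigr (fun=> 1)); last first.
  by move=> k _; rewrite (lt_trans _ yN')// ltr_nat.
rewrite sumr_const card_ord -mulr_natr mul1r; move: yN; rewrite -natr1 => yN.
by rewrite [true%:R]mulr1n ler_norml; apply/andP; split; lra.
Qed.

Lemma approximable_measurable f : measurable_fun setT f ->
  (forall x, `|f x| <= 1) -> approximable mu nu f.
Proof.
move=> mf f1.
pose y (n : nat) x := n.+1%:R / 2 * (f x + 1).
have my n : measurable_fun setT (y n).
  by apply: measurable_funM => //; exact: measurable_funD.
pose S n k : set (borel_rV R d) := [set x | k%:R < y n x].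
have mS n k : measurable (S n k).
  have -> : S n k = setT `&` y n @^-1` `]k%:R, +oo[%classic.
    by apply/seteqP; split => x; rewrite /S/= in_itv/= andbT //; case.
  exact: my.
pose F (n : nat) x : R := 2 / n.+1%:R * (\sum_(k < n.+1) \1_(S n k) x) + -1.
have SE n x : \sum_(k < n.+1) \1_(S n k) x = \sum_(k < n.+1) (k%:R < y n x)%R%:R :> R.
  apply: eq_bigr => k _; rewrite indicE; congr (nat_of_bool _)%:R.
  by apply/idP/idP; rewrite ?inE.
have n0 n : 0 < n.+1%:R :> R by rewrite ltr0n.
have Ff n x : `|F n x - f x| <= 2 / n.+1%:R.
  have -> : F n x - f x = 2 / n.+1%:R * (\sum_(k < n.+1) (k%:R < y n x)%R%:R - y n x).
    by rewrite /F SE /y; field; rewrite gt_eqF.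
  rewrite normrM gtr0_norm ?divr_gt0// ler_piMr ?divr_ge0//.
  apply: count_lt_dist; have := f1 x; rewrite ler_norml => /andP[g1 g2].
  rewrite /y mulr_ge0 ?divr_ge0//=; last lra.
  by rewrite -mulrA ler_piMr ?(ltW (n0 n))//; lra.
apply: (@approximable_lim _ _ _ _ F) => //.
- move=> n; apply: approximableD; last exact: approximable_cst.
  apply: approximableZ; apply: approximable_sum => k.
  exact: approximable_indic.
- move=> n; apply: measurable_funD => //; apply: measurable_funM => //.
  by apply: measurable_sum => k; exact: measurable_indic.
- move=> n x; rewrite /F SE.
  have s0 : 0 <= \sum_(k < n.+1) (k%:R < y n x)%R%:R :> R by apply: sumr_ge0.
  have s1 : \sum_(k < n.+1) (k%:R < y n x)%R%:R <= n.+1%:R :> R.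
    rewrite -natr_sum ler_nat -[leqRHS]card_ord -sum1_card leq_sum// => k _.
    exact: leq_b1.
  have : 2 / n.+1%:R * \sum_(k < n.+1) (k%:R < y n x)%R%:R <= 2 :> R.
    by rewrite -mulrA ler_piMr// mulrC ler_pdivrMr// mul1r.
  have : 0 <= 2 / n.+1%:R * \sum_(k < n.+1) (k%:R < y n x)%R%:R :> R.
    by rewrite mulr_ge0// divr_ge0.
  by move: (2 / _ * _) => z z0 z1; rewrite ler_norml; apply/andP; split; lra.
move=> x; apply/cvgrPdist_le => e e0.
exists (Num.bound (2 / e)) => // n /= en; rewrite distrC; apply: le_trans (Ff n x) _.
rewrite ler_pdivrMr// -ler_pdivrMl// mulrC.
have e20 : 0 <= 2 / e by rewrite divr_ge0// ltW.
apply: le_trans (ltW (archi_boundP e20)) _.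
by rewrite ler_nat (leq_trans en).
Qed.

Lemma integral_gap_measurable_le (b : R) f :
  (forall M (g : 'rV[R]_d -> R), l1_lipschitz M g -> (forall x, `|g x| <= 1) ->
    `|integral_gap mu nu g| <= b) ->
  measurable_fun setT f -> (forall x, `|f x| <= 1) ->
  `|integral_gap mu nu f| <= b.
Proof.
move=> hb mf f1; apply/ler_addgt0Pr => e e0.
have af := approximable_measurable mf f1.
have [M [g [gM g1 ge]]] := approximable_clamp af f1 e0.
have [If _] := af; have Ig := integrable2_lipschitz mu nu gM g1.
have If1 := integrable2_norm (integrable2B If Ig).
apply: le_trans (integral_gap_dist_le If Ig If1 (fun=> lexx _)) _.
by rewrite lerD// (hb M)//.
Qed.

End measurable_approximation.

Section cosine_test_functions.
Context {R : realType} {d : nat}.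
Implicit Types (u x : 'rV[R]_d) (a c : R).

Lemma dotp_is_linear u : linear (dotp u).
Proof.
move=> k x y; rewrite /dotp scaler_sumr -big_split/=; apply: eq_bigr => i _.
by rewrite !mxE mulrDr -mulrCA.
Qed.

HB.instance Definition _ u :=
  GRing.isLinear.Build R 'rV[R]_d R *:%R (dotp u) (dotp_is_linear u).

Lemma dotp_delta u i : dotp u (delta_mx 0 i) = u 0 i.
Proof.
rewrite /dotp (bigD1 i)//= mxE !eqxx mulr1 big1 ?addr0// => j ji.
by rewrite mxE (negPf ji) andbF mulr0.
Qed.

Lemma enormZ c u : enorm (c *: u) = `|c| * enorm u.
Proof.
rewrite /enorm -sqrtr_sqr -sqrtrM ?sqr_ge0//; congr Num.sqrt.
rewrite /dotp mulr_sumr; apply: eq_bigr => i _.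
by rewrite !mxE; ring.
Qed.

Definition cos_test u a : 'rV[R]_d -> R :=
  fun x => (1 + enorm u)^-1 * cos (dotp u x - a).

Lemma is_derive_cos_shift c a (t : R) :
  is_derive t 1 (fun s => c * cos (s - a)) (- (c * sin (t - a))).
Proof.
have h : is_derive t 1 (fun s : R => s - a) 1.
  have := is_deriveB (is_derive_id t (1 : R)) (is_derive_cst a t 1).
  by rewrite subr0.
have h2 := @is_derive1_comp _ cos (fun s : R => s - a) t _ _ (is_derive_cos (t - a)) h.
have := @is_deriveZ _ _ _ (cos \o (fun s : R => s - a)) c t 1 _ h2.
move=> h3; apply: is_derive_eq.
by rewrite /GRing.scale/= mulr1 mulrN.
Qed.

Lemma cos_test_diff u a x : differentiable (cos_test u a) x /\
  gradient (cos_test u a) x = - ((1 + enorm u)^-1 * sin (dotp u x - a)) *: u.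
Proof.
set c := (1 + enorm u)^-1.
pose h s := c * cos (s - a).
have dh : is_derive (dotp u x) 1 h (- (c * sin (dotp u x - a))).
  exact: is_derive_cos_shift.
have diffh : differentiable h (dotp u x) by apply/derivable1_diffP; case: dh.
have cu : continuous (dotp u) by exact: continuous_dotp.
have diffu : differentiable (dotp u) x by exact: (@linear_differentiable _ _ _ (dotp u)).
have diffc : differentiable (cos_test u a) x.
  exact: (differentiable_comp diffu diffh).
split => //; apply/rowP => i; rewrite [LHS]mxE deriveE//.
rewrite (_ : cos_test u a = h \o dotp u)// diff_comp//= diff1E// derive1E.
rewrite [X in _ *: X](@derive_val _ _ _ _ _ _ _ dh).
by rewrite (@diff_lin _ _ _ (dotp u))//= dotp_delta mxE; exact: mulrC.
Qed.

Lemma cos_test_FM u a : FM_test (cos_test u a).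
Proof.
have e0 := enorm_ge0 u; have e1 : 0 < 1 + enorm u by lra.
have c0 : 0 <= (1 + enorm u)^-1 by rewrite invr_ge0 ltW.
split.
  split; first by move=> x; case: (cos_test_diff u a x).
  have -> : gradient (cos_test u a) =
      (fun x => - ((1 + enorm u)^-1 * sin (dotp u x - a)) *: u).
    by apply/funext => x; case: (cos_test_diff u a x).
  move=> x; apply: (@continuousZr_tmp _ _ _
    (fun x => - ((1 + enorm u)^-1 * sin (dotp u x - a)))).
  apply: (@continuousN _ _ _ (fun x => (1 + enorm u)^-1 * sin (dotp u x - a))).
  apply: (@continuousM _ _ (fun=> (1 + enorm u)^-1)); first exact: cst_continuous.
  apply: (@continuous_comp _ _ _ (fun x : 'rV[R]_d => dotp u x - a) sin).
    by apply: (@continuousB _ _ _ (dotp u) (fun=> a)); [exact: continuous_dotp|exact: cst_continuous].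
  exact: continuous_sin.
apply: (@le_trans _ _ (((1 + enorm u)^-1)%R%:E + ((1 + enorm u)^-1 * enorm u)%R%:E)%E).
  apply: leeD; apply: ge_ereal_sup => _ [x _ <-]; rewrite lee_fin.
    by rewrite normrM ger0_norm// ler_piMr// cos_max.
  rewrite (cos_test_diff u a x).2 enormZ normrM normr_id normrN normrM.
  by rewrite (ger0_norm c0) (ger0_norm e0) ler_wpM2r// ler_piMr// sin_max.
by rewrite -EFinD lee_fin -[X in X + _]mulr1 -mulrDr mulVf// gt_eqF.
Qed.

End cosine_test_functions.

Section Fortet_Mourier_bounds.
Context {R : realType} {d : nat}.
Variables mu nu : probability (borel_rV R d) R.
Implicit Types (f : borel_rV R d -> R).

Lemma integral_gapE f : integrable2 mu nu f ->
  `|\int[mu]_x (f x)%:E - \int[nu]_x (f x)%:E|%E =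
  `|integral_gap mu nu f|%:E.
Proof.
move=> [fm fn]; rewrite /integral_gap /Rintegral.
rewrite -{1}(fineK (integrable_fin_num measurableT fm)).
by rewrite -{1}(fineK (integrable_fin_num measurableT fn)).
Qed.

Lemma FM_test_bounded (f : 'rV[R]_d -> R) : FM_test f ->
  continuous f /\ forall x, `|f x| <= 1.
Proof.
move=> [[df _] f1]; split; first by move=> x; exact: differentiable_continuous.
move=> x; rewrite -lee_fin; apply: le_trans f1.
apply: (@le_trans _ _ (sup_norm f)); first by apply: ereal_sup_ubound; exists x.
rewrite leeDl//; apply: (@le_trans _ _ `|enorm (gradient f 0)|%:E).
  by rewrite lee_fin.
by apply: ereal_sup_ubound; exists 0.
Qed.

Lemma dFM_fin : exists2 D : R, 0 <= D & dFM mu nu = D%:E.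
Proof.
have lt2 : (dFM mu nu <= 2%:E)%E.
  apply: ge_ereal_sup => _ [f /FM_test_bounded[cf f1] <-].
  have mf := continuous_measurable_borel_rV cf.
  rewrite integral_gapE; last exact: bounded_integrable2 mf f1.
  by rewrite lee_fin -[2]mulr1; exact: integral_gap_le2.
have gt0 : (0 <= dFM mu nu)%E.
  apply: (@le_trans _ _ _); last first.
    by apply: ereal_sup_ubound; exists (cos_test 0 0) => //; exact: cos_test_FM.
  exact: abse_ge0.
have fD : dFM mu nu \is a fin_num.
  by rewrite ge0_fin_numE//; exact: le_lt_trans lt2 (ltry _).
by exists (fine (dFM mu nu)); [exact: fine_ge0|rewrite fineK].
Qed.

Lemma integral_gap_cos_le_dFM (D : R) (u : 'rV[R]_d) (a : R) :
  dFM mu nu = D%:E ->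
  `|integral_gap mu nu (fun x => cos (dotp u x - a))| <= (1 + enorm u) * D.
Proof.
move=> DE; have e1 : 0 < 1 + enorm u by have := enorm_ge0 u; lra.
have Ic := integrable2_cos_dotp mu nu u a.
have : (`|integral_gap mu nu (cos_test u a)|%:E <= D%:E)%E.
  rewrite -integral_gapE -?DE; last exact: integrable2Z.
  by apply: ereal_sup_ubound; exists (cos_test u a) => //; exact: cos_test_FM.
rewrite lee_fin integral_gapZ// normrM normfV (gtr0_norm e1).
by rewrite ler_pdivrMl.
Qed.

Lemma dTV_le (b : R) :
  (forall f, measurable_fun setT f -> (forall x, `|f x| <= 1) ->
    `|integral_gap mu nu f| <= b) -> (dTV mu nu <= b%:E)%E.
Proof.
move=> hb; apply: ge_ereal_sup => _ [f [mf f1] <-].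
rewrite integral_gapE; last exact: bounded_integrable2 mf f1.
by rewrite lee_fin hb.
Qed.

End Fortet_Mourier_bounds.

Section characteristic_functions.
Context {R : realType} {d : nat} {disp : measure_display}
  {T : measurableType disp}.
Variables (P : probability T R) (X : {RV P >-> borel_rV R d}).

Let mu := distribution P X.

Lemma integral_distribution_bounded (f : borel_rV R d -> R) (M : R) :
  measurable_fun setT f -> (forall x, `|f x| <= M) ->
  \int[mu]_x f x = fine 'E_P[fun w => f (X w)].
Proof.
move=> mf fM; rewrite /Rintegral unlock; congr fine.
rewrite integral_distribution//; first exact/measurable_EFinP.
have mfX : measurable_fun setT (fun w => f (X w)) by exact: measurableT_comp.
by have [] := bounded_integrable2 P P mfX (fun w => fM (X w)).
Qed.

Lemma integral_cos_dotp_le (u : 'rV[R]_d) (a : R) :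
  `|\int[mu]_x cos (dotp u x - a)| <= ComplexField.Normc.normc (char_fun X u).
Proof.
set c := fine 'E_P[fun w => cos (dotp u (X w))].
set s := fine 'E_P[fun w => sin (dotp u (X w))].
have cE : \int[mu]_x cos (dotp u x) = c.
  apply: (@integral_distribution_bounded _ 1); last by move=> x; exact: cos_max.
  have := @measurable_cos_dotp R d u 0.
  by under eq_fun do rewrite subr0.
have sE : \int[mu]_x sin (dotp u x) = s.
  apply: (@integral_distribution_bounded _ 1); last by move=> x; exact: sin_max.
  have := @measurable_cos_dotp R d u (pi / 2).
  by under eq_fun do rewrite cosBpihalf.
have [Ic _] := integrable2_cos_dotp mu mu u 0.
have [Is _] := integrable2_cos_dotp mu mu u (pi / 2).
have {}Ic : mu.-integrable setT (EFin \o (fun x => cos (dotp u x))).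
  by move: Ic; rewrite (_ : (fun x => cos (dotp u x - 0)) = fun x => cos (dotp u x))//;
    apply/funext => x; rewrite subr0.
have {}Is : mu.-integrable setT (EFin \o (fun x => sin (dotp u x))).
  by move: Is; rewrite (_ : (fun x => cos (dotp u x - pi / 2)) = fun x => sin (dotp u x))//;
    apply/funext => x; rewrite cosBpihalf.
have -> : \int[mu]_x cos (dotp u x - a) = cos a * c + sin a * s.
  rewrite -cE -sE -!RintegralZl// -RintegralD//; [|
    exact: (integrableZl measurableT _ Ic)|exact: (integrableZl measurableT _ Is)].
  by apply: eq_Rintegral => x _; rewrite cosB mulrC [sin _ * _]mulrC.
have -> : char_fun X u = (c +i* s)%C by [].
rewrite /ComplexField.Normc.normc -sqrtr_sqr ler_wsqrtr//.
have := cos2Dsin2 a; move: (cos a) (sin a) => p q pq.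
have -> : c ^+ 2 + s ^+ 2 = (p ^+ 2 + q ^+ 2) * (c ^+ 2 + s ^+ 2) by rewrite pq mul1r.
have := sqr_ge0 (p * s - q * c); nra.
Qed.

Lemma integral_enorm (k : nat) (K : R) :
  ('E_P[fun w => (enorm (X w) ^+ k)%R] <= K%:E)%E ->
  mu.-integrable setT (EFin \o (fun x => enorm x ^+ k)) /\
  ((\int[mu]_x (enorm x ^+ k))%:E = 'E_P[fun w => (enorm (X w) ^+ k)%R])%E.
Proof.
have mk : measurable_fun setT (fun x : borel_rV R d => enorm x ^+ k).
  by apply: measurable_funX; exact: measurable_enorm.
have e0 (x : borel_rV R d) : (0 <= (enorm x ^+ k)%:E)%E.
  by rewrite lee_fin exprn_ge0// enorm_ge0.
have <- : (\int[mu]_x (enorm x ^+ k)%:E = 'E_P[fun w => (enorm (X w) ^+ k)%R])%E.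
  rewrite unlock (@ge0_integral_distribution _ _ _ _ _ P X (fun x => (enorm x ^+ k)%:E))//.
  exact/measurable_EFinP.
move=> h; have I : mu.-integrable setT (EFin \o (fun x => enorm x ^+ k)).
  apply/integrableP; split; first exact/measurable_EFinP.
  apply: le_lt_trans (ltry K); rewrite (eq_integral (fun x : borel_rV R d => (enorm x ^+ k)%:E))//.
  by move=> x _; exact: gee0_abs (e0 x).
by split => //; rewrite /Rintegral fineK//; exact: integrable_fin_num.
Qed.

End characteristic_functions.

Section optimization.
Context {R : realType}.
Implicit Types (A B C D b e g theta L : R).

Lemma geometric_interpolation C D b g theta (l m : nat) :
  0 <= C -> 0 <= D -> 1 <= b -> 0 < theta < 1 -> 0 <= g ->
  g <= b * D -> g <= C / b ^+ l -> m.+1%:R <= theta * l%:R ->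
  g <= C `^ theta * D `^ (1 - theta) * b ^- m.
Proof.
move=> C0 D0 b1 /andP[t0 t1] g0 gD gC lm.
have b0 : 0 < b by lra.
have -> : g = g `^ (1 - theta) * g `^ theta.
  by rewrite -powRD ?subrK ?powRr1// oner_eq0.
have gl : g `^ (1 - theta) <= b * D `^ (1 - theta).
  apply: (@le_trans _ _ ((b * D) `^ (1 - theta))).
    by apply: ge0_ler_powR => //; rewrite ?nnegrE ?mulr_ge0// ?(ltW b0)//; lra.
  rewrite powRM// ?(ltW b0)// ler_wpM2r ?powR_ge0// ler1_powR//; lra.
have gr : g `^ theta <= C `^ theta * b ^- m.+1.
  apply: (@le_trans _ _ ((C / b ^+ l) `^ theta)).
    by apply: ge0_ler_powR => //; rewrite ?nnegrE ?divr_ge0 ?exprn_ge0// ltW.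
  rewrite powRM// ?invr_ge0 ?exprn_ge0 ?(ltW b0)// ler_wpM2l ?powR_ge0//.
  rewrite -powR_invn ?(ltW b0)// -powRrM mulNr powRN mulrC.
  rewrite lef_pV2 ?posrE ?powR_gt0 ?exprn_gt0// -powR_mulrn ?(ltW b0)//.
  exact: ler_powR.
apply: le_trans (ler_pM (powR_ge0 _ _) (powR_ge0 _ _) gl gr) _.
rewrite le_eqVlt; apply/orP; left; apply/eqP.
by rewrite exprS; field; rewrite expf_neq0 gt_eqF.
Qed.

Lemma optimize_scale A B D e g (d k : nat) : (0 < d)%N ->
  0 <= A -> 0 <= B -> 0 <= D -> 0 < e < 1 -> g <= 2 ->
  1 <= e / (4 * d%:R) * k%:R ->
  (forall L, 1 <= L -> g <= A * D `^ (1 - e / 2) * L ^+ (2 * d) + B / L ^+ k) ->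
  g <= (A + B + 2) * D `^ (1 - e).
Proof.
move=> d0 A0 B0 D0 /andP[e0 e1] g2 ek gL.
have d1 : 0 < d%:R :> R by rewrite ltr0n.
have [DE|Dn0] := eqVneq D 0.
  have ne : 1 - e != 0 by rewrite gt_eqF//; lra.
  have ne2 : 1 - e / 2 != 0 by rewrite gt_eqF//; lra.
  rewrite DE powR0// mulr0; apply/ler_addgt0Pr => r r0; rewrite add0r.
  have k0 : (0 < k)%N by case: (k) ek => //; rewrite mulr0; lra.
  pose L := 1 + B / r.
  have L1 : 1 <= L by rewrite /L lerDl divr_ge0// ltW.
  apply: le_trans (gL L L1) _; rewrite DE powR0// mulr0 mul0r add0r.
  have L0 : 0 < L by lra.
  apply: (@le_trans _ _ (B / L)).
    rewrite ler_wpM2l// lef_pV2 ?posrE ?exprn_gt0//; exact: ler_eXnr.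
  rewrite ler_pdivrMr// /L mulrDr mulr1 mulrCA divff ?gt_eqF// mulr1; lra.
have Dp : 0 < D by rewrite lt_neqAle eq_sym Dn0.
have p0 := powR_ge0 D (1 - e).
have [D1|D1] := leP 1 D.
  have e1' : 0 <= 1 - e by lra.
  by have := ler_powR D1 e1'; rewrite powRr0; move: p0; move: (D `^ _) => *; nra.
pose eta := e / (4 * d%:R); pose L := D `^ (- eta).
have eta0 : 0 < eta by rewrite divr_gt0// mulr_gt0.
have D01 : 0 < D <= 1 by rewrite Dp ltW.
have L1 : 1 <= L by rewrite -(powRr0 D) /L ger_powR// oppr_le0 ltW.
apply: le_trans (gL L L1) _; rewrite !mulrDl.
have -> : A * D `^ (1 - e / 2) * L ^+ (2 * d) = A * D `^ (1 - e).
  rewrite -mulrA; congr (_ * _).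
  rewrite -(powR_mulrn _ (powR_ge0 _ _)) -powRrM -powRD ?Dn0 ?implybT//.
  by congr (_ `^ _); rewrite /eta natrM; field; rewrite gt_eqF.
have : B / L ^+ k <= B * D `^ (1 - e).
  rewrite ler_wpM2l// -(powR_mulrn _ (powR_ge0 _ _)) -powRrM mulNr powRN invrK.
  by apply: ger_powR => //; rewrite /eta; lra.
by have := powR_ge0 D (1 - e); lra.
Qed.

End optimization.


Lemma prod_coord_le_enorm (R : realType) (d : nat) (u : 'rV[R]_d) :
  (1 + enorm u) ^- (2 * d) <= \prod_i (1 + `|u 0 i|) ^- 2.
Proof.
have -> : (1 + enorm u) ^- (2 * d) = \prod_(i < d) (1 + enorm u) ^- 2.
  by rewrite prodr_const card_ord exprM exprVn.
apply: ler_prod => i _; have e0 := enorm_ge0 u.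
have e1 : 0 < 1 + enorm u by lra.
rewrite invr_ge0 exprn_ge0 ?(ltW e1)//= lef_pV2 ?posrE ?exprn_gt0 ?ltr_wpDr//.
by rewrite lerXn2r ?nnegrE ?addr_ge0 ?(ltW e1)// lerD2l coord_le_enorm.
Qed.


Theorem corollary2p3 (R : realType) (d : nat) (d_ge1 : (1 <= d)%N)
    (K C : nat -> R) (K_gt0 : forall k, 0 < K k) (C_gt0 : forall l, 0 < C l)
    (eps : R) (eps_gt0 : 0 < eps) (eps_lt1 : eps < 1) :
  exists Ceps : R,
    forall (disp1 disp2 : measure_display)
      (T1 : measurableType disp1) (T2 : measurableType disp2)
      (P1 : probability T1 R) (P2 : probability T2 R)
      (X1 : {RV P1 >-> borel_rV R d}) (X2 : {RV P2 >-> borel_rV R d}),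
    (forall k : nat,
      ('E_P1[fun w => (enorm (X1 w) ^+ k)%R] + 'E_P2[fun w => (enorm (X2 w) ^+ k)%R]
         <= (K k)%:E)%E) ->
    (forall (u : 'rV[R]_d) (l : nat),
      ComplexField.Normc.normc (char_fun X1 u)
        + ComplexField.Normc.normc (char_fun X2 u)
        <= C l / (1 + enorm u) ^+ l) ->
    (dTV (distribution P1 X1) (distribution P2 X2)
       <= Ceps%:E * dFM (distribution P1 X1) (distribution P2 X2) `^ (1 - eps))%E.
Proof.
pose theta := eps / 2.
have t01 : 0 < theta < 1 by rewrite /theta; apply/andP; split; lra.
have [t0 t1] := andP t01.
pose l := Num.bound ((2 * d).+1%:R / theta).
have lP : (2 * d).+1%:R <= theta * l%:R.
  rewrite -ler_pdivrMl// mulrC; apply: ltW; apply: archi_boundP.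
  by rewrite divr_ge0// ltW.
have d0 : 0 < d%:R :> R by rewrite ltr0n.
pose k := Num.bound ((4 * d%:R) / eps).
have kP : 1 <= eps / (4 * d%:R) * k%:R.
  rewrite -ler_pdivrMl ?divr_gt0 ?mulr_gt0// mulr1 invf_div.
  by apply: ltW; apply: archi_boundP; rewrite !divr_ge0 ?mulr_ge0// ltW.
pose A := C l `^ theta * 4 ^+ d; pose B := 2 * 4 ^+ k * K k.
exists (A + B + 2) => disp1 disp2 T1 T2 P1 P2 X1 X2 momX charX.
set mu := distribution P1 X1; set nu := distribution P2 X2.
have [D D0 DE] := dFM_fin mu nu; rewrite DE poweR_EFin -EFinM.
have A0 : 0 <= A by rewrite mulr_ge0 ?powR_ge0 ?exprn_ge0.
have B0 : 0 <= B by rewrite !mulr_ge0 ?exprn_ge0 ?(ltW (K_gt0 _)).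
have gap_cos (u : 'rV[R]_d) (a : R) :
    `|integral_gap mu nu (fun x => cos (dotp u x - a))| <=
      C l `^ theta * D `^ (1 - theta) * \prod_i (1 + `|u 0 i|) ^- 2.
  have b1 : 1 <= 1 + enorm u by rewrite lerDl enorm_ge0.
  have gC : `|integral_gap mu nu (fun x => cos (dotp u x - a))| <=
      C l / (1 + enorm u) ^+ l.
    apply: le_trans (ler_normB _ _) _; apply: le_trans (charX u l).
    by rewrite lerD// integral_cos_dotp_le.
  apply: le_trans (geometric_interpolation (ltW (C_gt0 l)) D0 b1 t01
    (normr_ge0 _) (integral_gap_cos_le_dFM u a DE) gC lP) _.
  by rewrite ler_wpM2l ?mulr_ge0 ?powR_ge0// prod_coord_le_enorm.
have E1 : ('E_P1[fun w => (enorm (X1 w) ^+ k)%R] <= (K k)%:E)%E.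
  apply: le_trans (momX k); rewrite leeDl// expectation_ge0// => w.
  by rewrite exprn_ge0 ?enorm_ge0.
have E2 : ('E_P2[fun w => (enorm (X2 w) ^+ k)%R] <= (K k)%:E)%E.
  apply: le_trans (momX k); rewrite leeDr// expectation_ge0// => w.
  by rewrite exprn_ge0 ?enorm_ge0.
have [I1 M1] := integral_enorm E1; have [I2 M2] := integral_enorm E2.
have tot : integral_total mu nu (fun x => enorm x ^+ k) <= K k.
  by rewrite -lee_fin EFinD M1 M2; exact: momX.
apply: dTV_le => f mf f1; apply: (integral_gap_measurable_le _ mf f1).
move=> M g gM g1; apply: (@optimize_scale _ A B D eps _ d k) => //.
- exact/andP.
- by rewrite -[2]mulr1; apply: integral_gap_le2 => //; exact: measurable_l1_lipschitz gM.
move=> L L1; have L0 : 0 < L by lra.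
apply: le_trans (integral_gap_lipschitz_le gap_cos L1 gM g1 (conj I1 I2)) _.
apply: lerD.
  rewrite exprMn -exprM /A -/theta le_eqVlt; apply/orP; left; apply/eqP; ring.
have -> : B / L ^+ k = 2 * (4 / L) ^+ k * K k by rewrite /B expr_div_n; ring.
by rewrite ler_wpM2l// mulr_ge0// exprn_ge0// divr_ge0// ltW.
Qed.
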